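(* MEFE-Matching can be solved in polynomial time on instances in which the difference between the degree and the capacity of each course is at most one, i.e., $d(x_i)-c_i\le 1$ for every course $x_i$. That is, there is a polynomial-time algorithm that, given such an instance, outputs a MEFE matching if one exists and correctly reports that none exists otherwise.
   Context: An instance of MEFE-Matching consists of: a finite set of courses $X=\{x_1,\dots,x_n\}$; a finite set of TAs $T=\{t_1,\dots,t_m\}$; for each TA $t_i$ a utility (valuation) function $u_i=u_{t_i}\colon X\to\mathbb{Z}_{\ge 0}$ and a grade function $g_i=g_{t_i}\colon X\to\mathbb{Q}_{\ge 0}$; for each course $x_i$ a capacity $c_i$ (a positive integer) and a utility (valuation) function $v_i=v_{x_i}\colon T\to\mathbb{Z}_{\ge 0}$, where for every TA $t$ and course $x_i$ one has $v_i(t)=0$ if $u_t(x_i)=0$ and $v_i(t)>0$ otherwise; and a number $k\in\mathbb{Q}_{\ge 0}$. All numbers are encoded in binary. The degree $d(x)$ of a course $x$ is the number of TAs it values positively. A matching is a function $\mu\colon T\to X\cup\{\emptyset\}$, where $\mu(t)=\emptyset$ means $t$ is unassigned; by convention $u_t(\emptyset)=0$. It is feasible if $|\mu^{-1}(x_i)|=c_i$ for every course $x_i$ and no TA $t$ is assigned to a course $x$ with $u_t(x)=0$. A MEFE (merit-based envy-free egalitarian) matching is a feasible matching $\mu$ such that (1) (satisfaction of courses) for every course $x_i$, $\mathrm{AvgUtil}(x_i)=\frac{1}{c_i}\sum_{t\in\mu^{-1}(x_i)}v_i(t)\ge k$; and (2) (merit-based envy-freeness) there are no two TAs $t_i,t_j$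 with $\mu(t_j)\in X$, $g_i(\mu(t_j))\ge g_j(\mu(t_j))$ and $u_i(\mu(t_j))>u_i(\mu(t_i))$. *)

(* Defs.v *)
(* MathComp *)
From HB Require Import structures.
From mathcomp Require Import all_boot all_order all_algebra.

Set Implicit Arguments.
Unset Strict Implicit.
Unset Printing Implicit Defensive.

Import Order.TTheory GRing.Theory Num.Theory.

Record instance := Instance {
  nb_courses : nat;
  nb_tas : nat;
  util : 'I_nb_tas -> 'I_nb_courses -> nat;
  grade : 'I_nb_tas -> 'I_nb_courses -> rat;
  capacity : 'I_nb_courses -> nat;
  value : 'I_nb_courses -> 'I_nb_tas -> nat;
  threshold : rat;
  grade_ge0 : forall t x, (0 <= grade t x)%R;
  capacity_gt0 : forall x, 0 < capacity x;
  value_eq0 : forall x t, (value x t == 0) = (util t x == 0);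
  threshold_ge0 : (0 <= threshold)%R
}.

Definition course (I : instance) := 'I_(nb_courses I).
Definition ta (I : instance) := 'I_(nb_tas I).

Definition degree (I : instance) (x : course I) : nat :=
  #|[set t : ta I | 0 < value x t]|.

(* [mu t = None] means that [t] is unassigned. *)
Definition matching (I : instance) := {ffun ta I -> option (course I)}.

Definition util_opt (I : instance) (t : ta I) (o : option (course I)) : nat :=
  if o is Some x then util t x else 0.

Definition feasible (I : instance) (mu : matching I) : Prop :=
  (forall x : course I, #|[set t : ta I | mu t == Some x]| = capacity x) /\
  (forall t : ta I, ~ exists2 x : course I, mu t = Some x & util t x = 0).

Definition avg_util (I : instance) (mu : matching I) (x : course I) : rat :=
  ((capacity x)%:R^-1 * \sum_(t : ta I | mu t == Some x) (value x t)%:R)%R.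

Definition courses_satisfied (I : instance) (mu : matching I) : Prop :=
  forall x : course I, (threshold I <= avg_util mu x)%R.

Definition merit_envy_free (I : instance) (mu : matching I) : Prop :=
  ~ exists (i j : ta I) (x : course I),
      [/\ mu j = Some x, (grade j x <= grade i x)%R
        & util_opt i (mu i) < util i x].

Definition MEFE (I : instance) (mu : matching I) : Prop :=
  [/\ feasible mu, courses_satisfied mu & merit_envy_free mu].

(* Polynomial time is measured on the random access machine with logarithmic
   cost (Cook-Reckhow; Aho-Hopcroft-Ullman, The Design and Analysis of Computer
   Algorithms, Section 1.3), which simulates and is simulated by Turing machines
   with polynomial overhead.  Registers are indexed by, and contain, natural
   numbers of arbitrary size. *)

Definition bitlen (a : nat) : nat := (trunc_log 2 a).+1.

Definition bitsize (s : seq nat) : nat := \sum_(a <- s) bitlen a.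

Definition memory := nat -> nat.

Inductive operand :=
  | Const of nat   (* the literal a *)
  | Reg of nat     (* the content of register a *)
  | Ind of nat.    (* the content of the register whose index is in register a *)

Inductive target :=
  | ToReg of nat
  | ToInd of nat.

Inductive arith := Add | Sub | Mul | Div.

Inductive instr :=
  | Move of target & operand
  | Arith of arith & target & operand & operand
  | Jump of nat
  | JumpZero of operand & nat.

Definition program := seq instr.

Definition read (M : memory) (o : operand) : nat :=
  match o with Const a => a | Reg a => M a | Ind a => M (M a) end.

Definition read_cost (M : memory) (o : operand) : nat :=
  match o with
  | Const a => bitlen a
  | Reg a => bitlen a + bitlen (M a)
  | Ind a => bitlen a + bitlen (M a) + bitlen (M (M a))
  end.

Definition address (M : memory) (d : target) : nat :=
  match d with ToReg a => a | ToInd a => M a end.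

Definition address_cost (M : memory) (d : target) : nat :=
  match d with ToReg a => bitlen a | ToInd a => bitlen a + bitlen (M a) end.

Definition write (M : memory) (a b : nat) : memory :=
  fun i => if i == a then b else M i.

(* [Sub] is truncated, and division by zero yields zero. *)
Definition arith_fun (op : arith) : nat -> nat -> nat :=
  match op with Add => addn | Sub => subn | Mul => muln | Div => divn end.

Definition step (i : instr) (pc : nat) (M : memory) : nat * memory :=
  match i with
  | Move d o => (pc.+1, write M (address M d) (read M o))
  | Arith op d o1 o2 =>
      (pc.+1, write M (address M d) (arith_fun op (read M o1) (read M o2)))
  | Jump l => (l, M)
  | JumpZero o l => (if read M o == 0 then l else pc.+1, M)
  end.

Definition step_cost (i : instr) (M : memory) : nat :=
  match i with
  | Move d o => address_cost M d + read_cost M o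
  | Arith op d o1 o2 =>
      address_cost M d + read_cost M o1 + read_cost M o2
      + bitlen (arith_fun op (read M o1) (read M o2))
  | Jump _ => 1
  | JumpZero o _ => read_cost M o
  end.

(* [exec P pc M c M']: started at instruction [pc] with memory [M], the program
   halts with memory [M'] after a run of total logarithmic cost [c].  It halts
   when the program counter leaves the program. *)
Inductive exec (P : program) : nat -> memory -> nat -> memory -> Prop :=
  | ExecHalt pc M : size P <= pc -> exec P pc M 0 M
  | ExecStep pc M c M' :
      pc < size P ->
      let i := nth (Jump 0) P pc in
      exec P (step i pc M).1 (step i pc M).2 c M' ->
      exec P pc M (step_cost i M + c) M'.

(* A sequence is stored with its length in register 0, followed by its items. *)
Definition load (s : seq nat) : memory := nth 0 (size s :: s).

Definition output (M : memory) : seq nat := [seq M i | i <- iota 1 (M 0)].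

Definition encode_rat (r : rat) : seq nat := [:: `|numq r|%N; `|denq r|%N].

(* Each row of a TA is prefixed by its length, so that the encoding has at least
   one item per TA even if there are no courses; otherwise [nb_tas], being
   written in binary, could be exponential in the size of the encoding. *)
Definition encode_ta (I : instance) (t : ta I) : seq nat :=
  nb_courses I :: [seq util t x | x <- enum 'I_(nb_courses I)]
    ++ flatten [seq encode_rat (grade t x) | x <- enum 'I_(nb_courses I)].

Definition encode_course (I : instance) (x : course I) : seq nat :=
  capacity x :: [seq value x t | t <- enum 'I_(nb_tas I)].

Definition encode (I : instance) : seq nat :=
  [:: nb_courses I; nb_tas I] ++ encode_rat (threshold I)
    ++ flatten [seq encode_ta t | t <- enum 'I_(nb_tas I)]
    ++ flatten [seq encode_course x | x <- enum 'I_(nb_courses I)].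

Definition encode_matching (I : instance) (mu : matching I) : seq nat :=
  [seq (if mu t is Some x then (val x).+1 else 0) | t <- enum 'I_(nb_tas I)].

Definition encode_answer (I : instance) (o : option (matching I)) : seq nat :=
  if o is Some mu then 1 :: encode_matching mu else [:: 0].

(* Main.v *)
(** Join each course to the TAs that it values.  As degree and capacity differ by
    at most one, a feasible matching amounts to an orientation of this graph with
    out-degrees at most one: a course points to the TA that it leaves out, a TA
    points to its course, and each edge is oriented exactly one way.  Whether a node
    may point to a given neighbour, or to none, can be read off the instance: a
    course that leaves out one TA takes all the others, which settles its average
    utility and the envy of that TA.

    If a decided node does not point to its neighbour [b], then [b] must point to it.
    So fixing the arrow out of one node [t] determines the arrows of all nodes from
    which [t] is reached along arrows.  Following the arrows of a solution from any
    node ends in a cycle, or in a node without an arrow, regarded as a loop; the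
    nodes that reach a given point of that cycle form a connected component.  Hence
    every solvable component is solved by propagation from one of polynomially many
    seeds, and a solution on a component can be accepted without regard to the
    others.

    The algorithm is written in a language of loops and arrays in which stored
    numbers never exceed those of the input, so that the cost on the machine is
    polynomial by induction on the program. *)
Require Import Defs.
From HB Require Import structures.
From mathcomp Require Import all_boot all_order all_algebra zify.
From Stdlib Require Import FunctionalExtensionality.

Set Implicit Arguments.
Unset Strict Implicit.
Unset Printing Implicit Defensive.

Import Order.TTheory GRing.Theory Num.Theory.

(** * Structured programs on the random access machine *)

(** Soundness owes nothing to propagation: whatever a seed leaves behind is checked before it is
    kept, so a wrong seed may produce contradictory arrows without any conflict being detected on
    the way. Completeness compares the run with one fixed solution [D], and concerns only the seeds
    [(t, D t)] with [t] periodic under [D]. For such a seed every forced arrow is an arrow of [D],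
    in whatever order arrows are forced, so that overwriting is harmless and no uniqueness of
    solutions is claimed. Arrows kept for different components may come from different solutions.
    All loops range over [1] to the number [L] of input items. This single bound covers nodes,
    seeds, rounds and output positions, because the encoding has at least one item per course and
    per TA; and [L] is at most the input size, whereas the numbers in the input may be exponential
    in it. The machine starts with the input in the very registers that a program computes with.
    Hence the relocation of the input before the main program and of the output after it. *)

Lemma bitlen_leq b a : 0 < b -> (bitlen a <= b) = (a < 2 ^ b).
Proof.
case: b => // b _; rewrite /bitlen ltnS; apply/idP/idP => [le_ab | lt_a].
  by apply: leq_trans (trunc_log_ltn a (isT : 1 < 2)) _; rewrite leq_exp2l.
case: (posnP a) => [->|a0]; first by rewrite trunc_log0.
by rewrite -ltnS -(ltn_exp2l _ _ (isT : 1 < 2)) (leq_ltn_trans (trunc_logP _ a0)).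
Qed.

Lemma bitlen0 : bitlen 0 = 1. Proof. by []. Qed.
Lemma bitlen1 : bitlen 1 = 1. Proof. by []. Qed.
Lemma bitlen2 : bitlen 2 = 2. Proof. by []. Qed.
Lemma bitlen3 : bitlen 3 = 2. Proof. by []. Qed.
Lemma bitlen4 : bitlen 4 = 3. Proof. by []. Qed.

Lemma ltn_exp_bitlen a : a < 2 ^ bitlen a.
Proof. by rewrite -bitlen_leq. Qed.

Lemma leq_bitlen a b : a <= b -> bitlen a <= bitlen b.
Proof. by move=> le_ab; rewrite ltnS leq_trunc_log. Qed.

Lemma bitlen_leqS a : bitlen a <= a.+1.
Proof. by rewrite bitlen_leq // ltnW // ltn_expl. Qed.

Lemma bitlenM a b : bitlen (a * b) <= bitlen a + bitlen b.
Proof. by rewrite bitlen_leq // expnD ltn_mul // ltn_exp_bitlen. Qed.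

Lemma bitlenD a b : bitlen (a + b) <= bitlen a + bitlen b.
Proof.
rewrite bitlen_leq // expnD.
have := ltn_exp_bitlen a; have := ltn_exp_bitlen b.
have : 1 < 2 ^ bitlen a by rewrite -{1}(expn0 2) ltn_exp2l.
have : 1 < 2 ^ bitlen b by rewrite -{1}(expn0 2) ltn_exp2l.
set x := 2 ^ _; set y := 2 ^ _; nia.
Qed.

(** At most [j] terms below [2 ^ w] are added, so a long sum lengthens numbers only by the length of
    its range. This makes it affordable to have sums as expressions. *)
Lemma bitlen_sum (F : nat -> nat) i j w : 0 < w ->
    (forall k, i <= k < j -> bitlen (F k) <= w) ->
  bitlen (\sum_(i <= k < j) F k) <= bitlen j + w.
Proof.
move=> w0 Fw; rewrite bitlen_leq ?addn_gt0 // expnD.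
apply: leq_ltn_trans (_ : j * (2 ^ w).-1 < _).
  apply: leq_trans (_ : \sum_(i <= k < j) (2 ^ w).-1 <= _).
    rewrite !big_nat; apply: leq_sum => k /Fw.
    by rewrite bitlen_leq //; case: (2 ^ w).
  by rewrite sum_nat_const_nat leq_mul2r leq_subr orbT.
have := ltn_exp_bitlen j; have : 0 < 2 ^ w by rewrite expn_gt0.
set x := 2 ^ w; set y := 2 ^ _; nia.
Qed.

(** Lengths add up at worst, even under multiplication; this is what lets [width] add over the
    operands of [Bin]. *)
Lemma bitlen_arith op a b : bitlen (arith_fun op a b) <= bitlen a + bitlen b.
Proof.
case: op => /=; rewrite ?bitlenM ?bitlenD //.
  by apply: leq_trans (leq_addr _ _); rewrite leq_bitlen // leq_subr.
by apply: leq_trans (leq_addr _ _); rewrite leq_bitlen // leq_div.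
Qed.

Lemma write_same M a b : write M a b a = b.
Proof. by rewrite /write eqxx. Qed.

Lemma write_other M a b i : i != a -> write M a b i = M i.
Proof. by rewrite /write => /negPf->. Qed.

Inductive rcmd :=
  | Basic of instr
  | RSkip
  | RSeq of rcmd & rcmd
  | RIf of operand & rcmd
  | RWhile of operand & rcmd.

Fixpoint assemble (pc : nat) (c : rcmd) : program :=
  match c with
  | Basic i => [:: i]
  | RSkip => [::]
  | RSeq c1 c2 =>
      let p1 := assemble pc c1 in p1 ++ assemble (pc + size p1) c2
  | RIf o c1 =>
      let p1 := assemble pc.+1 c1 in JumpZero o (pc.+1 + size p1) :: p1
  | RWhile o c1 =>
      let p1 := assemble pc.+1 c1 in
      JumpZero o (pc + size p1 + 2) :: rcons p1 (Jump pc)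
  end.

Definition straight (i : instr) :=
  match i with Move _ _ | Arith _ _ _ _ => true | _ => false end.

(** The [1] in [EvWhile] pays for the jump back to the test. *)
Inductive reval : rcmd -> memory -> nat -> memory -> Prop :=
  | EvBasic i M : straight i -> reval (Basic i) M (step_cost i M) (step i 0 M).2
  | EvSkip M : reval RSkip M 0 M
  | EvSeq c1 c2 M k1 M1 k2 M2 :
      reval c1 M k1 M1 -> reval c2 M1 k2 M2 -> reval (RSeq c1 c2) M (k1 + k2) M2
  | EvIf0 o c M : read M o = 0 -> reval (RIf o c) M (read_cost M o) M
  | EvIf o c M k M1 :
      read M o != 0 -> reval c M k M1 -> reval (RIf o c) M (read_cost M o + k) M1
  | EvWhile0 o c M : read M o = 0 -> reval (RWhile o c) M (read_cost M o) M
  | EvWhile o c M k1 M1 k2 M2 :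
      read M o != 0 -> reval c M k1 M1 -> reval (RWhile o c) M1 k2 M2 ->
      reval (RWhile o c) M (read_cost M o + k1 + 1 + k2) M2.

Lemma exec_next P pc M i k c M' :
    pc < size P -> nth (Jump 0) P pc = i ->
    exec P (step i pc M).1 (step i pc M).2 c M' ->
  k = step_cost i M + c -> exec P pc M k M'.
Proof. by move=> lt_pc <- ex ->; apply: ExecStep. Qed.

(** [exec] describes only runs that end in halting, so the run of a fragment is expressed by what it
    puts in front of an arbitrary run continuing after it. *)
Lemma reval_exec c M k M1 : reval c M k M1 ->
  forall p1 p2 k2 M2, let p := assemble (size p1) c in
    exec (p1 ++ p ++ p2) (size p1 + size p) M1 k2 M2 ->
  exec (p1 ++ p ++ p2) (size p1) M (k + k2) M2.
Proof.
have at_head (p1 : program) i q : nth (Jump 0) (p1 ++ i :: q) (size p1) = i.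
  by rewrite nth_cat ltnn subnn.
have lt_head (p1 : program) i q : size p1 < size (p1 ++ i :: q).
  by rewrite size_cat /= -addSnnS leq_addr.
elim=> [i m st|m|c1 c2 m k1 m1 k2 m2 _ IH1 _ IH2|o d m o0|o d m k1 m1 o1 _ IH
  |o d m o0|o d m k1 m1 k2 m2 o1 _ IH1 _ IH2] p1 p2 k' M' /= ex.
- apply: exec_next (lt_head _ _ _) (at_head _ _ _) _ (erefl _).
  by move: ex; case: i st => //= *; rewrite -addn1.
- by rewrite add0n -[size p1]addn0.
- rewrite -addnA -catA; apply: (IH1 p1); rewrite catA -size_cat.
  move: ex; rewrite -[(_ ++ _) ++ p2]catA size_cat addnA -size_cat [p1 ++ _]catA => ex.
  exact: IH2.
- apply: exec_next (lt_head _ _ _) (at_head _ _ _) _ (erefl _).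
  by move: ex; rewrite /= o0 -[in X in X -> _]addSnnS.
- rewrite -addnA; apply: exec_next (lt_head _ _ _) (at_head _ _ _) _ (erefl _).
  rewrite /= (negPf o1); set j := JumpZero _ _.
  have /= := IH (rcons p1 j) p2 k' M'; rewrite size_rcons cat_rcons; apply.
  by rewrite addSnnS.
- apply: exec_next (lt_head _ _ _) (at_head _ _ _) _ (erefl _).
  by move: ex; rewrite /= o0 size_rcons addn2 !addnS.
- have -> : read_cost m o + k1 + 1 + k2 + k' = read_cost m o + (k1 + (1 + (k2 + k'))).
    lia.
  apply: exec_next (lt_head _ _ _) (at_head _ _ _) _ (erefl _).
  rewrite /= (negPf o1); set j := JumpZero _ _; set p := assemble _ _.
  have /= := IH1 (rcons p1 j) (Jump (size p1) :: p2) (1 + (k2 + k')) M'.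
  rewrite size_rcons cat_rcons -/p -cats1 -catA; apply.
  have sz : size (p1 ++ j :: p) = (size p1).+1 + size p.
    by rewrite size_cat /= addSnnS.
  rewrite -sz -cat_cons catA.
  apply: exec_next (lt_head _ _ _) (at_head _ _ _) _ (erefl _).
  have /= := IH2 p1 p2 k' M'; rewrite -/p -/j cat_rcons -catA; apply.
  by move: ex; rewrite -/p -/j cat_rcons.
Qed.

Lemma reval_program c M k M1 : reval c M k M1 -> exec (assemble 0 c) 0 M k M1.
Proof.
move=> ev; have := reval_exec ev (p1 := [::]) (p2 := [::]) (k2 := 0) (M2 := M1).
by rewrite /= cats0 addn0; apply; apply: ExecHalt; rewrite add0n.
Qed.

(** A Hoare triple for total correctness with a cost bound, taken at a single initial memory. *)
Definition runs (c : rcmd) (M : memory) (B : nat) (Q : memory -> Prop) :=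
  exists k M1, [/\ reval c M k M1, k <= B & Q M1].

Lemma runs_weaken c M B B' (Q Q' : memory -> Prop) :
  runs c M B Q -> B <= B' -> (forall M1, Q M1 -> Q' M1) -> runs c M B' Q'.
Proof.
move=> [k [M1 [ev le_k q]]] leB QQ; exists k, M1; split => //; last exact: QQ.
exact: leq_trans leB.
Qed.

Lemma runs_le c M B B' Q : runs c M B Q -> B <= B' -> runs c M B' Q.
Proof. by move=> rB leB; apply: runs_weaken rB leB _. Qed.

Lemma runs_basic i M B (Q : memory -> Prop) :
  straight i -> step_cost i M <= B -> Q (step i 0 M).2 -> runs (Basic i) M B Q.
Proof.
move=> st le_B q; exists (step_cost i M), (step i 0 M).2.
by split=> //; apply: EvBasic.
Qed.

Lemma runs_seq c1 c2 M B1 B2 B (Q1 Q : memory -> Prop) :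
    runs c1 M B1 Q1 -> (forall M1, Q1 M1 -> runs c2 M1 B2 Q) -> B1 + B2 <= B ->
  runs (RSeq c1 c2) M B Q.
Proof.
move=> [k1 [M1 [ev1 le1 /[swap] /[apply]]]] [k2 [M2 [ev2 le2 q]]] leB.
exists (k1 + k2), M2; split => //; first exact: EvSeq ev2.
exact: leq_trans (leq_add le1 le2) leB.
Qed.

Lemma runs_if o c M B (Q : memory -> Prop) :
    (read M o = 0 -> Q M) -> (read M o != 0 -> runs c M B Q) ->
  runs (RIf o c) M (read_cost M o + B) Q.
Proof.
move=> q0 q1; case: (eqVneq (read M o) 0) => [o0|/[dup] o1 /q1].
  by exists (read_cost M o), M; split; [apply: EvIf0 | rewrite leq_addr | apply: q0].
move=> [k [M1 [ev le_k q]]]; exists (read_cost M o + k), M1.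
by split; rewrite ?leq_add2l //; apply: EvIf.
Qed.

(* [Inv n] holds when [n] iterations remain. *)
Lemma runs_while (Inv : nat -> memory -> Prop) r c n M B :
    (forall k M1, k <= n -> Inv k M1 -> M1 r = k) ->
    (forall k M1, k < n -> Inv k.+1 M1 -> runs c M1 B (Inv k)) ->
    Inv n M ->
  runs (RWhile (Reg r) c) M (n.+1 * (bitlen r + bitlen n + B + 1)) (Inv 0).
Proof.
move=> InvE step; set C := bitlen r + bitlen n.
have: n <= n by []; move: {-2}n => j; elim: j M => [|k IH] M le_k inv.
  exists (read_cost M (Reg r)), M; split => //=; first by apply: EvWhile0; apply: InvE inv.
  by rewrite mul1n (InvE _ _ le_k inv) /C; have := leq_bitlen le_k; lia.
have [k1 [M1 [ev1 le1 /IH[]]]] := step _ _ le_k inv; first exact: ltnW.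
move=> k2 [M2 [ev2 le2 inv0]]; exists (read_cost M (Reg r) + k1 + 1 + k2), M2.
split => //=; first by apply: EvWhile ev2 => //=; rewrite (InvE _ _ le_k inv).
rewrite (InvE _ _ le_k inv) mulSn leq_add //.
by have := leq_bitlen le_k; rewrite /C; lia.
Qed.

(** * A language with arrays and bounded loops *)

Variant array := Input | Trial | Kept | Output.

Coercion array_id (a : array) : nat :=
  match a with Input => 0 | Trial => 1 | Kept => 2 | Output => 3 end.

(** [Sum] is an expression and not a loop with an accumulator, since a stored accumulator could
    grow. Counting and universal quantification are reduced to it. *)
Inductive expr :=
  | Lit of nat
  | Var of nat
  | Bin of arith & expr & expr
  | Get of array & expr
  | Sum of nat & expr.

Inductive cmd :=
  | Store of array & expr & expr
  | Seq of cmd & cmd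
  | If of expr & cmd
  | For of nat & cmd.

Definition upd (V : nat -> nat) (x i : nat) : nat -> nat :=
  fun y => if y == x then i else V y.

Definition store := array -> nat -> nat.

Definition set_cell (H : store) (a : array) (i v : nat) : store :=
  fun a' i' => if (a' == a :> nat) && (i' == i) then v else H a' i'.

Fixpoint eval (L : nat) (H : store) (V : nat -> nat) (e : expr) : nat :=
  match e with
  | Lit c => c
  | Var x => V x
  | Bin op e1 e2 => arith_fun op (eval L H V e1) (eval L H V e2)
  | Get a e1 => H a (eval L H V e1)
  | Sum x e1 => \sum_(1 <= i < L.+1) eval L H (upd V x i) e1
  end.

(** The index descends from [n] to 1 because the compiled loop counts a register down and tests it
    against zero. *)
Fixpoint downfrom (T : Type) (f : nat -> T -> T) (n : nat) (s : T) : T :=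
  if n is k.+1 then downfrom f k (f n s) else s.

Fixpoint run (L : nat) (V : nat -> nat) (c : cmd) (H : store) : store :=
  match c with
  | Store a e v => set_cell H a (eval L H V e) (eval L H V v)
  | Seq c1 c2 => run L V c2 (run L V c1 H)
  | If e c1 => if eval L H V e == 0 then H else run L V c1 H
  | For x c1 => downfrom (fun i => run L (upd V x i) c1) L H
  end.

(* Registers below [nreg] hold the loop variables and temporaries, register 0
   the bound of all loops; the arrays are interleaved above [nreg]. *)
Definition nreg := 48.

Definition cell (M : memory) : store := fun a i => M (nreg + 4 * i + a).

Fixpoint expr_regs (e : expr) : nat :=
  match e with
  | Lit _ | Var _ => 1
  | Bin _ e1 e2 => maxn (expr_regs e1) (expr_regs e2).+1
  | Get _ e1 => expr_regs e1
  | Sum _ e1 => (expr_regs e1).+2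
  end.

Fixpoint cmd_regs (c : cmd) : nat :=
  match c with
  | Store _ e v => maxn (expr_regs e) (expr_regs v).+1
  | Seq c1 c2 => maxn (cmd_regs c1) (cmd_regs c2)
  | If e c1 => maxn (expr_regs e) (cmd_regs c1)
  | For _ c1 => (cmd_regs c1).+1
  end.

(* Stored values never exceed the contents of the memory, so that numbers do not
   grow however long the program runs. *)
Fixpoint bounded_stores (c : cmd) : bool :=
  match c with
  | Store _ _ (Lit v) => v <= 1
  | Store _ _ (Var _ | Get _ _) => true
  | Store _ _ _ => false
  | Seq c1 c2 => bounded_stores c1 && bounded_stores c2
  | If _ c1 | For _ c1 => bounded_stores c1
  end.

Definition rarith op d o1 o2 := Basic (Arith op (ToReg d) o1 o2).
Definition rmove d o := Basic (Move (ToReg d) o).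

Definition locate (a : array) (d : nat) : rcmd :=
  RSeq (rarith Mul d (Reg d) (Const 4)) (rarith Add d (Reg d) (Const (nreg + a))).

(* [r] gives the registers of the variables; registers from [d] on are free. *)
Fixpoint compile_expr (r : nat -> nat) (d : nat) (e : expr) : rcmd :=
  match e with
  | Lit c => rmove d (Const c)
  | Var x => rmove d (Reg (r x))
  | Bin op e1 e2 =>
      RSeq (compile_expr r d e1)
        (RSeq (compile_expr r d.+1 e2) (rarith op d (Reg d) (Reg d.+1)))
  | Get a e1 => RSeq (compile_expr r d e1) (RSeq (locate a d) (rmove d (Ind d)))
  | Sum x e1 =>
      RSeq (rmove d (Const 0)) (RSeq (rmove d.+1 (Reg 0))
        (RWhile (Reg d.+1)
          (RSeq (compile_expr (upd r x d.+1) d.+2 e1)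
            (RSeq (rarith Add d (Reg d) (Reg d.+2))
                  (rarith Defs.Sub d.+1 (Reg d.+1) (Const 1))))))
  end.

Fixpoint compile_cmd (r : nat -> nat) (d : nat) (c : cmd) : rcmd :=
  match c with
  | Store a e v =>
      RSeq (compile_expr r d e) (RSeq (compile_expr r d.+1 v)
        (RSeq (locate a d) (Basic (Move (ToInd d) (Reg d.+1)))))
  | Seq c1 c2 => RSeq (compile_cmd r d c1) (compile_cmd r d c2)
  | If e c1 => RSeq (compile_expr r d e) (RIf (Reg d) (compile_cmd r d c1))
  | For x c1 =>
      RSeq (rmove d (Reg 0)) (RWhile (Reg d)
        (RSeq (compile_cmd (upd r x d) d.+1 c1) (rarith Defs.Sub d (Reg d) (Const 1))))
  end.

(** A static factor: if cells and the loop bound have at most [S] bits, the value of [e] has at most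
    [width e * S]. [Sum] adds two because its upper index [L.+1] has at most [S + 1 <= 2 * S]
    bits. *)
Fixpoint width (e : expr) : nat :=
  match e with
  | Lit c => bitlen c
  | Var _ | Get _ _ => 1
  | Bin _ e1 e2 => width e1 + width e2
  | Sum _ e1 => (width e1).+2
  end.

(** Here [S] bounds the lengths of the stored numbers and also the number of iterations of a loop.
    The constants are generous; what counts is that the result is polynomial in [S] for each fixed
    expression. *)
Fixpoint expr_cost (e : expr) (S : nat) : nat :=
  match e with
  | Lit c => nreg + bitlen c
  | Var _ => 2 * nreg + S
  | Bin _ e1 e2 =>
      expr_cost e1 S + expr_cost e2 S + (3 * nreg + 2 * (width e1 + width e2) * S)
  | Get _ e1 => expr_cost e1 S + (10 * nreg + 10 * (width e1).+1 * S + 20 * nreg)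
  | Sum _ e1 =>
      nreg + 1 + (2 * nreg + S) +
      S.+1 * (nreg + S + (expr_cost e1 S + (6 * nreg + 4 * (width e1).+3 * S)) + 1)
  end.

Fixpoint cmd_cost (c : cmd) (S : nat) : nat :=
  match c with
  | Store _ e v =>
      expr_cost e S + expr_cost v S +
      (20 * nreg + 10 * (width e + width v).+1 * S + 20 * nreg)
  | Seq c1 c2 => cmd_cost c1 S + cmd_cost c2 S
  | If e c1 => expr_cost e S + (nreg + width e * S + cmd_cost c1 S)
  | For _ c1 =>
      2 * nreg + S + S.+1 * (nreg + S + (cmd_cost c1 S + (4 * nreg + 2 * S)) + 1)
  end.

(** Registers 1 to [nreg - 1] are exempt: they hold intermediate results, which may be longer than
    [S]. *)
Definition bounded (S : nat) (M : memory) :=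
  bitlen (M 0) <= S /\ forall i, nreg <= i -> bitlen (M i) <= S.

Lemma eval_width L H V S e :
    L <= S -> bitlen L <= S -> (forall a i, bitlen (H a i) <= S) ->
  (forall x, V x <= L) -> bitlen (eval L H V e) <= width e * S.
Proof.
move=> LS LS' HS; have S0 : 0 < S by apply: leq_trans LS'.
elim: e V => [c|x|op e1 IH1 e2 IH2|a e1 _|x e1 IH] V VL /=.
- by rewrite leq_pmulr.
- by rewrite mul1n (leq_trans _ LS') // leq_bitlen.
- by rewrite mulnDl (leq_trans (bitlen_arith _ _ _)) // leq_add ?IH1 ?IH2.
- by rewrite mul1n HS.
have w0 : 0 < width e1 by elim: e1 {IH} => //= _ e1 w1 e2 w2; rewrite addn_gt0 w1.
apply: leq_trans (bitlen_sum (w := width e1 * S) _ _) _; first by rewrite muln_gt0 w0.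
  move=> k /andP[_ lt_k]; apply: IH => y; rewrite /upd.
  by case: eqP => _; [rewrite -ltnS | apply: VL].
have := bitlenD L 1; rewrite addn1 bitlen1; nia.
Qed.

Definition agree (d : nat) (M M1 : memory) :=
  forall i, (i < d) || (nreg <= i) -> M1 i = M i.

Lemma agree_cell d M M1 : agree d M M1 -> cell M1 = cell M.
Proof.
move=> agr; do 2!apply: functional_extensionality => ?.
by rewrite /cell agr // orbC -addnA leq_addr.
Qed.

Lemma agree0 d M M1 : 0 < d -> agree d M M1 -> M1 0 = M 0.
Proof. by move=> d0 -> //; rewrite d0. Qed.

Lemma agree_bounded S d M M1 : 0 < d -> agree d M M1 -> bounded S M -> bounded S M1.
Proof.
move=> d0 agr [bM0 bM]; split=> [|i le_i]; first by rewrite (agree0 d0 agr).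
by rewrite agr ?bM // le_i orbT.
Qed.

Lemma agree_trans d d' M1 M2 M3 :
  d <= d' -> agree d M1 M2 -> agree d' M2 M3 -> agree d M1 M3.
Proof.
move=> le_d a12 a23 i lt_i; rewrite a23 ?a12 //.
by case/orP: lt_i => [/leq_trans->|->] //; rewrite orbT.
Qed.

Lemma agree_write d M M1 i v :
  agree d M M1 -> d <= i < nreg -> agree d M (write M1 i v).
Proof.
move=> agr /andP[le_i lt_i] j lt_j; rewrite /write agr //.
by case: eqP lt_j => // ->; rewrite ltnNge le_i leqNgt lt_i.
Qed.

Definition valuation (r : nat -> nat) (d : nat) (M : memory) (V : nat -> nat) :=
  forall x, [/\ r x < d, M (r x) = V x & V x <= M 0].

Lemma agree_valuation r d d' M M1 V :
  0 < d -> d <= d' -> agree d M M1 -> valuation r d M V -> valuation r d' M1 V.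
Proof.
move=> d0 le_d agr val x; have [lt_r MV VL] := val x.
by rewrite (agree0 d0 agr) agr ?lt_r //; split=> //; apply: leq_trans le_d.
Qed.

Lemma valuation_upd r d d' M V x i j :
    valuation r d M V -> d <= i < d' -> M i = j -> j <= M 0 ->
  valuation (upd r x i) d' M (upd V x j).
Proof.
move=> val /andP[le_i lt_i] Mi jL y; rewrite /upd; case: eqP => // _.
have [lt_r MV VL] := val y; split=> //.
exact: leq_trans lt_r (leq_trans le_i (ltnW lt_i)).
Qed.

Lemma bitlen_reg d : d < nreg -> bitlen d <= nreg.
Proof. exact: leq_trans (bitlen_leqS d). Qed.

Lemma nreg_large : 39 < nreg. Proof. by []. Qed.

Lemma bitlen_base (a : array) : bitlen (nreg + a) <= nreg + 4.
Proof. by apply: leq_trans (bitlen_leqS _) _; case: a => /=; lia. Qed.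

Lemma locate_ok (a : array) d M B : d < nreg -> bitlen (M d) <= B ->
  runs (locate a d) M (8 * nreg + 4 * B)
    (fun M1 => [/\ M1 d = nreg + 4 * M d + a, bitlen (M1 d) <= B + nreg + 7
               & forall i, i != d -> M1 i = M i]).
Proof.
move=> lt_d MdB; have := bitlen_reg lt_d; have := nreg_large => n40 bd.
have b4 : bitlen (M d * 4) <= B + 3.
  by apply: leq_trans (bitlenM _ _) _; rewrite leq_add.
have ba := bitlen_base a.
have bs : bitlen (M d * 4 + (nreg + a)) <= B + nreg + 7.
  by apply: leq_trans (bitlenD _ _) _; apply: leq_trans (leq_add b4 ba) _; lia.
apply: (@runs_seq _ _ _ (2 * nreg + 2 * B + 6) (4 * nreg + 2 * B + 20)
          _ (fun M1 => M1 = write M d (M d * 4))); last by lia.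
  by apply: runs_basic => //=; rewrite ?bitlen4; lia.
move=> _ ->; apply: runs_basic => //=; rewrite /write eqxx; first by lia.
split=> //; first by lia.
by move=> i /negPf->.
Qed.

Lemma expr_regs_gt0 e : 0 < expr_regs e.
Proof. by elim: e => //= *; rewrite leq_max orbT. Qed.

Lemma width_gt0 e : 0 < width e.
Proof. by elim: e => //= _ e1 w1 e2 w2; rewrite addn_gt0 w1. Qed.

Lemma expr_width S r d M V e : bounded S M -> M 0 <= S -> valuation r d M V ->
  bitlen (eval (M 0) (cell M) V e) <= width e * S.
Proof.
move=> [bL bM] LS val; apply: eval_width => // [a i|x]; last by case: (val x).
by apply: bM; rewrite -addnA leq_addr.
Qed.

Lemma compile_expr_ok S e r d M V :
    0 < d -> d + expr_regs e <= nreg -> bounded S M -> M 0 <= S ->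
    valuation r d M V ->
  runs (compile_expr r d e) M (expr_cost e S)
    (fun M1 => M1 d = eval (M 0) (cell M) V e /\ agree d M M1).
Proof.
have n40 := nreg_large.
elim: e r d M V => [c|x|op e1 IH1 e2 IH2|a e1 IH|x e1 IH] r d M V d0 /= dK bM LS val.
- have lt_d : d < nreg by lia.
  apply: runs_basic => //=; first by have := bitlen_reg lt_d; lia.
  by rewrite /write eqxx; split=> //; apply: agree_write; rewrite ?leqnn.
- have lt_d : d < nreg by lia.
  have [lt_r MV VL] := val x.
  have bV : bitlen (V x) <= S by apply: leq_trans bM.1; apply: leq_bitlen.
  apply: runs_basic => //=; rewrite MV.
    by have := bitlen_reg lt_d; have := bitlen_reg (ltn_trans lt_r lt_d); lia.
  by rewrite /write eqxx; split=> //; apply: agree_write; rewrite ?leqnn.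
- have lt_d : d.+1 < nreg by have := expr_regs_gt0 e2; lia.
  have b1 := expr_width e1 bM LS val; have b2 := expr_width e2 bM LS val.
  apply: (runs_seq (B1 := expr_cost e1 S)
    (B2 := expr_cost e2 S + (3 * nreg + 2 * (width e1 + width e2) * S))).
  + by apply: IH1 val => //; lia.
  + move=> M1 [M1d agr1].
    apply: (runs_seq (B1 := expr_cost e2 S)
      (B2 := 3 * nreg + 2 * (width e1 + width e2) * S)) => //.
      apply: IH2 (agree_valuation d0 (leqnSn d) agr1 val) => //; first by lia.
        exact: agree_bounded agr1 bM.
      by rewrite (agree0 d0 agr1).
    move=> M2; rewrite (agree0 d0 agr1) (agree_cell agr1) => -[M2d agr2].
    have {}M1d : M2 d = eval (M 0) (cell M) V e1 by rewrite agr2 ?leqnn.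
    apply: runs_basic => //=; rewrite M1d M2d.
      have := bitlen_reg lt_d; have := bitlen_reg (ltnW lt_d).
      have := bitlen_arith op (eval (M 0) (cell M) V e1) (eval (M 0) (cell M) V e2).
      by lia.
    rewrite {1}/write eqxx; split=> //.
    apply: agree_write; last by rewrite leqnn ltnW.
    exact: agree_trans (leqnSn d) agr1 agr2.
  + by lia.
- have lt_d : d < nreg by have := expr_regs_gt0 e1; lia.
  have b1 := expr_width e1 bM LS val.
  apply: (runs_seq (B1 := expr_cost e1 S)
    (B2 := 10 * nreg + 10 * (width e1).+1 * S + 20 * nreg)) => //.
    exact: IH val.
  move=> M1 [M1d agr1]; rewrite -M1d in b1.
  apply: (runs_seq (B2 := 20 * nreg + 6 * (width e1).+1 * S) (locate_ok a lt_d b1)).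
    move=> M2 [M2d bM2 M2E].
    have M2c : M2 (M2 d) = cell M a (eval (M 0) (cell M) V e1).
      rewrite -M1d -(agree_cell agr1) M2E M2d; last by lia.
      by [].
    apply: runs_basic => //=; rewrite M2c.
      have : bitlen (cell M a (eval (M 0) (cell M) V e1)) <= S.
        by apply: bM.2; rewrite -addnA leq_addr.
      by have := bitlen_reg lt_d; lia.
    rewrite {1}/write eqxx; split=> //.
    apply: agree_write; last by rewrite leqnn.
    move=> i lt_i; rewrite M2E ?agr1 //.
    by apply: contraTneq lt_i => ->; rewrite ltnn leqNgt lt_d.
  by lia.
- have lt_d : d.+2 < nreg by have := expr_regs_gt0 e1; lia.
  pose F i := eval (M 0) (cell M) (upd V x i) e1.
  (* The counter in [d.+1] descends, so with [k] iterations to go the accumulator in [d] holds the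
     terms above [k]. *)
  pose Inv k M1 := [/\ agree d M M1, M1 d.+1 = k
                      & M1 d = \sum_(k.+1 <= i < (M 0).+1) F i].
  have S0 : 0 < S by apply: leq_trans bM.1.
  have w0 : 0 < width e1 * S by rewrite muln_gt0 width_gt0.
  have bF i : i <= M 0 -> bitlen (F i) <= width e1 * S.
    move=> le_i; apply: eval_width => // [|a j|y]; first exact: bM.1.
      by apply: bM.2; rewrite -addnA leq_addr.
    by rewrite /upd; case: eqP => // _; case: (val y).
  have bsum k : bitlen (\sum_(k.+1 <= i < (M 0).+1) F i) <= (width e1).+2 * S.
    apply: leq_trans (bitlen_sum w0 _) _; first by move=> i /andP[_ /bF].
    by have := bitlenD (M 0) 1; have := bM.1; rewrite addn1 ?bitlen1; lia.
  apply: (runs_seq (B1 := nreg + 1) (Q1 := fun M1 => agree d M M1 /\ M1 d = 0)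
    (B2 := 2 * nreg + S +
      S.+1 * (nreg + S + (expr_cost e1 S + (6 * nreg + 4 * (width e1).+3 * S)) + 1))).
  + apply: runs_basic => //=.
      by have := bitlen_reg (ltnW (ltnW lt_d)); rewrite bitlen0; lia.
    rewrite {2}/write eqxx; split=> //.
    by apply: agree_write => //; rewrite leqnn ltnW // ltnW.
  + move=> M1 [agr1 M1d].
    apply: (runs_seq (B1 := 2 * nreg + S) (Q1 := Inv (M 0))
      (B2 := (M 0).+1 * (bitlen d.+1 + bitlen (M 0)
                         + (expr_cost e1 S + (6 * nreg + 4 * (width e1).+3 * S)) + 1))).
    * apply: runs_basic => //=; rewrite (agree0 d0 agr1).
        by have := bitlen_reg (ltnW lt_d); have := bM.1; rewrite ?bitlen0; lia.
      rewrite /Inv {2 3}/write eqxx M1d big_geq // ltn_eqF //; split=> //.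
      by apply: agree_write => //; rewrite leqnSn ltnW.
    * move=> M2 Inv2; apply: runs_weaken (runs_while _ _ Inv2) (leqnn _) _.
      + by move=> k M3 _ [].
      + move=> k M3 lt_k [agr3 M3d1 M3d].
        have le_k : k.+1 <= M3 0 by rewrite (agree0 d0 agr3).
        have val3 : valuation (upd r x d.+1) d.+2 M3 (upd V x k.+1).
          apply: valuation_upd (agree_valuation d0 (leqnn d) agr3 val) _ M3d1 le_k.
          by rewrite leqnSn leqnn.
        apply: (runs_seq (B1 := expr_cost e1 S)
          (B2 := 6 * nreg + 4 * (width e1).+3 * S)) => //.
          apply: IH val3 => //; first by lia.
            exact: agree_bounded agr3 bM.
          by rewrite (agree0 d0 agr3).
        move=> M4; rewrite (agree0 d0 agr3) (agree_cell agr3) => -[M4d2 agr4].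
        rewrite -/(F k.+1) in M4d2.
        have M4d : M4 d = \sum_(k.+2 <= i < (M 0).+1) F i.
          by rewrite agr4 ?M3d // ltnW.
        have M4d1 : M4 d.+1 = k.+1 by rewrite agr4 ?ltnSn.
        have sumS : M4 d + M4 d.+2 = \sum_(k.+1 <= i < (M 0).+1) F i.
          by rewrite M4d M4d2 [RHS]big_ltn ?ltnS // addnC.
        have b2 := bitlen_reg lt_d; have b1 := bitlen_reg (ltnW lt_d).
        have b0 := bitlen_reg (ltnW (ltnW lt_d)).
        apply: (runs_seq (B1 := 3 * nreg + 3 * (width e1).+3 * S)
           (B2 := 3 * nreg + (width e1).+3 * S)
           (Q1 := fun M5 => M5 = write M4 d (M4 d + M4 d.+2))).
        * apply: runs_basic => //=; rewrite sumS M4d M4d2.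
          have := bsum k; have := bsum k.+1; have := bF k.+1.
          move=> /(_ lt_k) bF1 bs1 bs2; lia.
        * move=> _ ->; apply: runs_basic => //=.
            rewrite /write [d.+1 == d]gtn_eqF // M4d1 subn1 /=.
            have : bitlen k.+1 <= S by apply: leq_trans bM.1; apply: leq_bitlen.
            have : bitlen k <= S.
              by apply: leq_trans bM.1; apply: leq_bitlen; apply: ltnW.
            by rewrite ?bitlen1; lia.
          rewrite /Inv; split.
          - do 2![apply: agree_write; last by lia].
            by apply: agree_trans agr4 => //; lia.
          - by rewrite /write eqxx [d.+1 == d]gtn_eqF // M4d1 subn1.
          - by rewrite /write ltn_eqF // eqxx sumS.
        * by lia.
      + move=> M3 [agr3 _ ->]; split=> //.
    * have := bitlen_reg (ltnW lt_d); have := bM.1; set A := expr_cost e1 S + _.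
      rewrite leq_add2l => bL bd; apply: leq_mul; first by rewrite ltnS.
      by lia.
  + by lia.
Qed.

Lemma cell_write M (a : array) i v :
  cell (write M (nreg + 4 * i + a) v) = set_cell (cell M) a i v.
Proof.
apply: functional_extensionality => a'; apply: functional_extensionality => j.
rewrite /cell /write /set_cell; congr (if _ then _ else _).
by apply/eqP/andP => [eq_ij|[/eqP-> /eqP->]] //; split; apply/eqP; move: eq_ij;
  case: a a' => -[] /=; lia.
Qed.

Lemma bounded_write S M i v :
  bounded S M -> bitlen v <= S -> bounded S (write M i v).
Proof.
move=> [b0 bM] bv; split=> [|j le_j]; rewrite /write; case: eqP => // _.
exact: bM.
Qed.

Lemma stored_bitlen S r d M V a e v :
    bounded S M -> valuation r d M V -> bounded_stores (Store a e v) ->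
  bitlen (eval (M 0) (cell M) V v) <= S.
Proof.
move=> [b0 bM] val; have S0 : 0 < S by apply: leq_trans b0.
case: v => //= [c|x _|a' i _]; first by case: c => [|[]].
  by have [_ _ VL] := val x; apply: leq_trans (leq_bitlen VL) b0.
by apply: bM; rewrite -addnA leq_addr.
Qed.

Lemma compile_cmd_ok S c r d M V :
    0 < d -> d + cmd_regs c <= nreg -> bounded_stores c -> bounded S M -> M 0 <= S ->
    valuation r d M V ->
  runs (compile_cmd r d c) M (cmd_cost c S)
    (fun M1 => [/\ forall i, i < d -> M1 i = M i, bounded S M1
                 & cell M1 = run (M 0) V c (cell M)]).
Proof.
have n40 := nreg_large.
elim: c r d M V => [a e v|c1 IH1 c2 IH2|e c IH|x c IH] r d M V d0 dK st bM LS val.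
- rewrite /= in dK; have lt_d : d.+1 < nreg by have := expr_regs_gt0 v; lia.
  have b1 := expr_width e bM LS val; have b2 := expr_width v bM LS val.
  have bv := stored_bitlen bM val st.
  apply: (runs_seq (B1 := expr_cost e S) (B2 := expr_cost v S +
    (20 * nreg + 10 * (width e + width v).+1 * S + 20 * nreg))).
  + by apply: compile_expr_ok val => //; lia.
  + move=> M1 [M1d agr1].
    have bM1 := agree_bounded d0 agr1 bM.
    apply: (runs_seq (B1 := expr_cost v S)
      (B2 := 20 * nreg + 10 * (width e + width v).+1 * S + 20 * nreg)) => //.
      apply: compile_expr_ok (agree_valuation d0 (leqnSn d) agr1 val) => //.
        by lia.
      by rewrite (agree0 d0 agr1).
    move=> M2; rewrite (agree0 d0 agr1) (agree_cell agr1) => -[M2d agr2].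
    have {}M1d : M2 d = eval (M 0) (cell M) V e by rewrite agr2 ?leqnn.
    rewrite -M1d in b1.
    apply: (runs_seq (B2 := 20 * nreg + 6 * (width e).+1 * S)
                     (locate_ok a (ltnW lt_d) b1)); last by lia.
    move=> M3 [M3d bM3 M3E].
    have M3d1 : M3 d.+1 = eval (M 0) (cell M) V v by rewrite M3E ?gtn_eqF.
    have agr3 : agree d M M3.
      move=> i lt_i; rewrite M3E; first exact: agree_trans agr1 agr2 _ lt_i.
      by apply: contraTneq lt_i => ->; rewrite ltnn leqNgt ltnW.
    apply: runs_basic => //=; rewrite M3d1.
      by have := bitlen_reg lt_d; have := bitlen_reg (ltnW lt_d); lia.
    split.
    * move=> i lt_i; rewrite /write M3d ltn_eqF ?agr3 ?lt_i //.
      by rewrite -addnA ltn_addr // (ltn_trans lt_i (ltnW lt_d)).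
    * exact: bounded_write (agree_bounded d0 agr3 bM) bv.
    * by rewrite M3d cell_write M1d (agree_cell agr3).
  + by rewrite /=; lia.
- rewrite /= in dK st; case/andP: st => st1 st2.
  apply: (runs_seq (B1 := cmd_cost c1 S) (B2 := cmd_cost c2 S)) => //.
    by apply: IH1 val => //; lia.
  move=> M1 [M1E bM1 cM1]; have M10 := M1E 0 d0.
  apply: runs_weaken (IH2 r d M1 V d0 _ st2 bM1 _ _) _ _ => //.
  + by lia.
  + by rewrite M10.
  + by move=> y; have [lt_r MV VL] := val y; rewrite M1E // M10.
  + by move=> M2 [M2E bM2 cM2]; split=> // [i lt_i|]; rewrite ?M2E ?M1E // cM2 M10 cM1.
- rewrite /= in dK st.
  have b1 := expr_width e bM LS val.
  have lt_d : d < nreg by have := expr_regs_gt0 e; lia.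
  apply: (runs_seq (B1 := expr_cost e S)
           (B2 := nreg + width e * S + cmd_cost c S)) => //.
    by apply: compile_expr_ok val => //; lia.
  move=> M1 [M1d agr1]; rewrite -M1d in b1.
  apply: (runs_le (B := read_cost M1 (Reg d) + cmd_cost c S)).
  + apply: runs_if => /= [eq0|neq0].
      split; first by move=> i lt_i; rewrite agr1 // lt_i.
        exact: agree_bounded agr1 bM.
      by rewrite -M1d eq0 (agree_cell agr1).
    apply: runs_weaken (IH r d M1 V d0 _ st _ _ _) (leqnn _) _; first by lia.
    - exact: agree_bounded agr1 bM.
    - by rewrite (agree0 d0 agr1).
    - exact: agree_valuation agr1 val.
    move=> M2 [M2E bM2 cM2]; split=> //.
      by move=> i lt_i; rewrite M2E // agr1 // lt_i.
    by rewrite cM2 (agree0 d0 agr1) (agree_cell agr1) -M1d (negPf neq0).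
  + by have := bitlen_reg lt_d; rewrite /=; lia.
- rewrite /= in dK st; have lt_d : d < nreg by lia.
  pose f i := run (M 0) (upd V x i) c.
  (* Running the remaining iterations from the present memory gives the result of the whole loop; no
     intermediate store has to be described. *)
  pose Inv k M1 := [/\ forall i, i < d -> M1 i = M i, M1 d = k, bounded S M1
                      & downfrom f k (cell M1) = downfrom f (M 0) (cell M)].
  apply: (runs_seq (B1 := 2 * nreg + S) (Q1 := Inv (M 0))
    (B2 := (M 0).+1 * (bitlen d + bitlen (M 0)
                       + (cmd_cost c S + (4 * nreg + 2 * S)) + 1))).
  + have := bitlen_reg lt_d; have := bM.1 => b0 bd.
    apply: runs_basic => //=; first by rewrite ?bitlen0; lia.
    have agr : agree d M (write M d (M 0)) by apply: agree_write; rewrite ?leqnn.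
    split=> [i lt_i|||].
    - by rewrite /write ltn_eqF.
    - by rewrite /write eqxx.
    - exact: agree_bounded agr bM.
    - by rewrite (agree_cell agr).
  + move=> M1 Inv1; apply: runs_weaken (runs_while _ _ Inv1) (leqnn _) _.
    - by move=> k M2 _ [].
    - move=> k M2 lt_k [M2E M2d bM2 cM2]; have M20 := M2E 0 d0.
      apply: (runs_seq (B1 := cmd_cost c S) (B2 := 4 * nreg + 2 * S)) => //.
        apply: (IH (upd r x d) d.+1 M2 (upd V x k.+1)) => //; first by lia.
          by rewrite M20.
        apply: (@valuation_upd r d) => //; rewrite ?M20 ?leqnn //.
        by move=> y; have [lt_r MV VL] := val y; rewrite M2E // M20.
      move=> M3 [M3E bM3 cM3]; have M3d : M3 d = k.+1 by rewrite M3E.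
      have agr : agree d M3 (write M3 d k) by apply: agree_write; rewrite ?leqnn.
      have bk1 : bitlen k.+1 <= S by apply: leq_trans bM.1; apply: leq_bitlen.
      have bk := leq_trans (leq_bitlen (leqnSn k)) bk1.
      apply: runs_basic => //=; rewrite M3d subSS subn0.
        by have := bitlen_reg lt_d; rewrite ?bitlen1; lia.
      split=> [i lt_i|||].
      * by rewrite /write ltn_eqF // M3E ?M2E // ltnW.
      * by rewrite /write eqxx.
      * exact: agree_bounded agr bM3.
      * by rewrite (agree_cell agr) cM3 M20 -cM2.
    - by move=> M2 [M2E M2d bM2 cM2].
  + have := bitlen_reg lt_d; have := bM.1 => bL bd.
    rewrite /= leq_add2l; apply: leq_mul; first by rewrite ltnS.
    by lia.
Qed.

(** * Moving input and output between registers and arrays *)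

Lemma runs_skip M B (Q : memory -> Prop) : Q M -> runs RSkip M B Q.
Proof. by move=> q; exists 0, M; split=> //; apply: EvSkip. Qed.

Lemma runs_step i c M B1 B2 B (Q : memory -> Prop) :
    straight i -> step_cost i M <= B1 -> runs c (step i 0 M).2 B2 Q ->
    B1 + B2 <= B ->
  runs (RSeq (Basic i) c) M B Q.
Proof.
move=> st le1 rc leB.
apply: (runs_seq (Q1 := fun M1 => M1 = (step i 0 M).2)) leB; first exact: runs_basic.
by move=> _ ->.
Qed.

(* Items [1 .. nreg] of the input and of the output are kept above the others,
   out of the way of the registers. *)
Definition pos (L i : nat) := if i <= nreg then L + nreg + i else i.

(** Unrolled instead of a loop: registers 1 to [nreg] may all hold items, so only register 0 is free
    to serve as a pointer. The same holds when they are restored. *)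
Fixpoint save_regs (k : nat) : rcmd :=
  if k is j.+1 then
    RSeq (save_regs j)
      (RSeq (rarith Add 0 (Reg 0) (Const 1)) (Basic (Move (ToInd 0) (Reg k))))
  else RSkip.

Fixpoint restore_regs (k : nat) : rcmd :=
  if k is j.+1 then
    RSeq (restore_regs j)
      (RSeq (rarith Add 0 (Reg 0) (Const 1)) (rmove k (Ind 0)))
  else RSkip.

(** The copy runs from the top down: cell [p] goes to [nreg + 4 * p], which lies above all cells
    still to be copied. *)
Definition prologue : rcmd :=
  RSeq (rarith Add 0 (Reg 0) (Const nreg)) (RSeq (save_regs nreg)
    (RSeq (rarith Defs.Sub 1 (Reg 0) (Const nreg))
      (RSeq (RWhile (Reg 1)
         (RSeq (rarith Add 2 (Reg 1) (Const nreg)) (RSeq (rmove 3 (Reg 2))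
           (RSeq (locate Input 3) (RSeq (Basic (Move (ToInd 3) (Ind 2)))
             (rarith Defs.Sub 1 (Reg 1) (Const 1)))))))
        (rarith Defs.Sub 0 (Reg 0) (Const (2 * nreg)))))).

(** The copy runs upwards: item [p] comes from [nreg + 4 * p + 3], so writing to [p] destroys no
    source still to be read. *)
Definition epilogue : rcmd :=
  RSeq (rmove 0 (Reg (nreg + 4 * 0 + Output)))
    (RSeq (rmove 1 (Const nreg)) (RSeq (rarith Add 2 (Reg 0) (Const nreg))
      (RSeq (RWhile (Reg 2)
         (RSeq (rarith Add 1 (Reg 1) (Const 1)) (RSeq (rmove 3 (Reg 1))
           (RSeq (locate Output 3) (RSeq (Basic (Move (ToInd 1) (Ind 3)))
             (rarith Defs.Sub 2 (Reg 2) (Const 1)))))))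
        (RSeq (rarith Add 0 (Reg 0) (Const nreg)) (RSeq (restore_regs nreg)
          (rarith Defs.Sub 0 (Reg 0) (Const (2 * nreg)))))))).

Lemma save_regs_ok S b k M : M 0 = b -> k <= b ->
    (forall i, 0 < i <= k -> bitlen (M i) <= S) ->
  runs (save_regs k) M (k * (2 * S + 6 * (b + k) + 20))
    (fun M1 => M1 0 = b + k /\
       forall i, i != 0 -> M1 i = if b < i <= b + k then M (i - b) else M i).
Proof.
move=> M0; elim: k => [|k IH] le_k bM.
  apply: runs_skip; rewrite addn0 M0; split=> // i _.
  by rewrite ltnNge; case: (i <= b).
have {}IH := IH (ltnW le_k).
apply: (runs_seq (B2 := 2 * S + 6 * (b + k.+1) + 20) (IH _)).
- by move=> i /andP[i0 /leqW le_i]; apply: bM; rewrite i0.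
- move=> M1 [M10 M1E]; have M1k : M1 k.+1 = M k.+1.
    by rewrite M1E // ltnNge le_k.
  have := bM k.+1 (leqnn _) => bk; have := bitlen_leqS k.+1 => bk1.
  have := bitlen_leqS (b + k) => bbk; have := bitlen_leqS (b + k).+1 => bbk1.
  apply: (@runs_step _ _ _ (2 * (b + k) + 10) (2 * S + 4 * (b + k) + 10)) => //=;
    last by lia.
    by rewrite M10 addn1 ?bitlen0 ?bitlen1; lia.
  apply: runs_basic => //=; rewrite /write M10 addn1 /= M1k; first by rewrite ?bitlen0; lia.
  rewrite addnS; split=> // i i0.
  case: (eqVneq i (b + k).+1) => [->|ne_i].
    by rewrite ltnS leq_addr leqnn subSn ?leq_addr // addKn.
  rewrite (negPf i0) M1E //; congr (if _ then _ else _); move: ne_i; lia.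
- by lia.
Qed.

Lemma restore_regs_ok S b k M : M 0 = b -> k <= b ->
    (forall i, 0 < i <= k -> bitlen (M (b + i)) <= S) ->
  runs (restore_regs k) M (k * (2 * S + 6 * (b + k) + 20))
    (fun M1 => M1 0 = b + k /\
       forall i, i != 0 -> M1 i = if i <= k then M (b + i) else M i).
Proof.
move=> M0; elim: k => [|k IH] le_k bM.
  by apply: runs_skip; rewrite addn0 M0; split=> // i; rewrite leqn0 => /negPf->.
have {}IH := IH (ltnW le_k).
apply: (runs_seq (B2 := 2 * S + 6 * (b + k.+1) + 20) (IH _)).
- by move=> i /andP[i0 /leqW le_i]; apply: bM; rewrite i0.
- move=> M1 [M10 M1E].
  have M1k : M1 (b + k).+1 = M (b + k).+1.
    by rewrite M1E // ltnNge (leq_trans (leq_addl b k)).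
  have := bM k.+1 (leqnn _); rewrite addnS => bk; have := bitlen_leqS k.+1 => bk1.
  have := bitlen_leqS (b + k) => bbk; have := bitlen_leqS (b + k).+1 => bbk1.
  apply: (@runs_step _ _ _ (2 * (b + k) + 10) (2 * S + 4 * (b + k) + 10)) => //=;
    last by lia.
    by rewrite M10 addn1 ?bitlen0 ?bitlen1; lia.
  apply: runs_basic => //=; rewrite /write M10 addn1 /= M1k; first by rewrite ?bitlen0; lia.
  split=> // i i0; rewrite (negPf i0).
  case: (eqVneq i k.+1) => [->|ne_i]; first by rewrite leqnn addnS.
  by rewrite M1E //; congr (if _ then _ else _); move: ne_i; lia.
- by lia.
Qed.

Definition transfer_cost (S : nat) := 20 * S + 50 * nreg + 100.

Definition prologue_cost (S : nat) :=
  (5 * S + 20 * nreg + 20) + (nreg * (2 * S + 6 * (S + 2 * nreg) + 20)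
    + (5 * S + 20 * nreg + 20
    + ((S + nreg).+1 * (2 + (S + nreg).+1 + transfer_cost S + 1)
    + (5 * S + 20 * nreg + 20)))).

Definition epilogue_cost (S : nat) :=
  (nreg + 7 + S + 1) + ((2 + nreg.+1) + ((20 * nreg + 5 * S + 20)
    + ((S + nreg).+1 * (2 + (S + nreg).+1 + transfer_cost S + 1)
    + ((20 * nreg + 5 * S + 20) + (nreg * (2 * S + 6 * (S + 2 * nreg) + 20)
    + (20 * nreg + 5 * S + 20)))))).

Lemma prologue_ok s S : size s <= S -> (forall i, bitlen (load s i) <= S) ->
  runs prologue (load s) (prologue_cost S)
    (fun M1 => [/\ M1 0 = size s, forall i, nreg <= i -> bitlen (M1 i) <= S
      & forall i, 0 < i <= size s -> cell M1 Input (pos (size s) i) = load s i]).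
Proof.
move=> le_s bM; have n40 := nreg_large.
(* Adding [nreg] before saving puts the saved copies beyond register [nreg] even if the input is
   shorter than that. *)
set b := size s + nreg; pose top := b + nreg.
have bl x : bitlen x <= x.+1 by apply: bitlen_leqS.
apply: (runs_step (B1 := 5 * S + 20 * nreg + 20)
  (B2 := nreg * (2 * S + 6 * (S + 2 * nreg) + 20)
    + (5 * S + 20 * nreg + 20
    + ((S + nreg).+1 * (2 + (S + nreg).+1 + transfer_cost S + 1)
    + (5 * S + 20 * nreg + 20))))) => //=.
  have := bl (size s); have := bl nreg; have := bl (size s + nreg).
  by rewrite /load /= ?bitlen0; lia.
set M0 := write _ _ _; have M00 : M0 0 = b by [].
have M0E i : i != 0 -> M0 i = load s i by rewrite /M0 /write => /negPf->.
apply: (runs_seq (B1 := nreg * (2 * S + 6 * (S + 2 * nreg) + 20))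
  (B2 := 5 * S + 20 * nreg + 20
    + ((S + nreg).+1 * (2 + (S + nreg).+1 + transfer_cost S + 1)
    + (5 * S + 20 * nreg + 20)))).
- apply: runs_le (save_regs_ok (S := S) M00 (leq_addl _ _) _) _.
    by move=> [|i] //= _; rewrite M0E.
  by rewrite leq_mul2l /b; lia.
- move=> M1 []; rewrite -/top => M10 M1E.
  have bM1 i : i != 0 -> bitlen (M1 i) <= S.
    by move=> i0; rewrite M1E //; case: ifP => lt_i; rewrite M0E //; lia.
  apply: (runs_step (B1 := 5 * S + 20 * nreg + 20)
  (B2 := (S + nreg).+1 * (2 + (S + nreg).+1 + transfer_cost S + 1)
    + (5 * S + 20 * nreg + 20))) => //=.
    have := bl top; have := bl nreg; have := bl (top - nreg); rewrite M10.
    by rewrite ?bitlen0 ?bitlen1 /top /b; lia.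
  rewrite M10; have -> : top - nreg = b by rewrite /top addnK.
  set M2 := write _ _ _.
  pose Inv q M3 := [/\ M3 1 = q, M3 0 = top, 
    forall p, nreg < p <= q + nreg -> M3 p = M1 p,
    forall p, q + nreg < p <= top -> M3 (nreg + 4 * p) = M1 p &
    forall i, nreg <= i -> bitlen (M3 i) <= S].
  have Inv2 : Inv b M2.
    rewrite /Inv /M2 /write /=; split=> //.
    + by move=> p /andP[lt_p _]; rewrite gtn_eqF // (leq_ltn_trans _ lt_p).
    + by move=> p; rewrite -/top; lia.
    + by move=> i le_i; rewrite gtn_eqF ?bM1 //; lia.
  apply: (runs_seq (B2 := 5 * S + 20 * nreg + 20) _ _ (leqnn _)).
  + apply: runs_le (runs_while (B := transfer_cost S) _ _ Inv2) _.
    * by move=> q M3 _ [].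
    * move=> q M3 lt_q [M31 M30 M3lo M3hi bM3].
      have [p pE] : exists p, p = q.+1 + nreg by exists (q.+1 + nreg).
      have bp := bl p; have bpS : p <= S + 2 * nreg by move: lt_q; rewrite /b; lia.
      have bn := bl nreg; have bq := bl q; have bq1 := bl q.+1.
      apply: (runs_step (B1 := 2 * nreg + 5 * p + 20)
        (B2 := transfer_cost S - (2 * nreg + 5 * p + 20))) => //=.
      - by rewrite M31 -pE bitlen2 bitlen1; lia.
      - rewrite M31 -pE.
        apply: (runs_step (B1 := p + 10)
          (B2 := transfer_cost S - (3 * nreg + 6 * p + 30))) => //=.
        * by rewrite write_same bitlen2 bitlen3; lia.
        * rewrite write_same; set M4 := write _ _ _.
          have M43 : M4 3 = p by rewrite /M4 /write.
          have M4E i : i != 2 -> i != 3 -> M4 i = M3 i.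
            by rewrite /M4 /write => /negPf-> /negPf->.
          have b3 : bitlen (M4 3) <= p.+1 by rewrite M43.
          apply: (runs_seq (B2 := transfer_cost S - (11 * nreg + 10 * p + 50))
            (locate_ok Input _ b3)) => //.
          + move=> M5 []; rewrite M43 addn0 => M53 bM5 M5E.
            have M52 : M5 2 = p by rewrite M5E // /M4 /write.
            have M5p : M5 p = M1 p.
              rewrite M5E ?M4E ?M3lo //; move: pE; lia.
            have M51 : M5 1 = q.+1 by rewrite M5E ?M4E.
            apply: (runs_step (B1 := S + 2 * nreg + 5 * p + 20) (B2 := 2 * q + 20)) => //=.
            * rewrite M52 M5p bitlen2 bitlen3.
              have : bitlen (M1 p) <= S by apply: bM1; move: pE; lia.
              by move: bM5; lia.
            * rewrite M53 M52 M5p; set M6 := write _ _ _.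
              have M61 : M6 1 = q.+1 by rewrite /M6 /write M51 ltn_eqF //; lia.
              apply: runs_basic => //=; rewrite M61 subSS subn0 ?bitlen1; first by lia.
              have M6E i : i != 2 -> i != 3 -> i != nreg + 4 * p -> M6 i = M3 i.
                by move=> ? ? /negPf ne; rewrite /M6 /write ne M5E ?M4E.
              split.
              + by [].
              + by rewrite {1}/write /= M6E //; lia.
              + move=> i lt_i; rewrite /write gtn_eqF ?M6E ?M3lo //; lia.
              + move=> i lt_i; rewrite /write gtn_eqF; last by lia.
                rewrite /M6 /write eqn_add2l eqn_mul2l /=.
                case: eqP => [->//|ne_i].
                by rewrite M5E ?M4E ?M3hi //; lia.
              + move=> i le_i; rewrite /write gtn_eqF; last by lia.
                rewrite /M6 /write; case: eqP => [_|_]; first by apply: bM1; lia.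
                by rewrite M5E ?M4E ?bM3 //; lia.
            * by rewrite /transfer_cost; lia.
          + by rewrite /transfer_cost; lia.
        * by rewrite /transfer_cost; lia.
      - by rewrite /transfer_cost; lia.
    * rewrite bitlen1; apply: leq_mul; first by rewrite /b; lia.
      by have := bl b; rewrite /b; lia.
  + move=> M3 [M31 M30 _ M3hi bM3].
    apply: runs_basic => //=.
      rewrite M30 bitlen0; have := bl top; have := bl (2 * nreg).
      by have := bl (top - 2 * nreg); rewrite /top /b; lia.
    split.
    * by rewrite {1}/write /= M30 /top /b; lia.
    * by move=> i le_i; rewrite /write gtn_eqF ?bM3 //; lia.
    * move=> i lt_i; rewrite /cell addn0 /write /= M3hi /top /b /pos; last first.
        by case: ifP; lia.
      rewrite M1E; last by case: ifP; lia.
      case/andP: lt_i => i0 le_i; rewrite -/b; case: (leqP i nreg) => lt_n.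
        have -> : b < b + i <= b + nreg by lia.
        by rewrite addKn M0E -?lt0n.
      have -> : (b < i <= b + nreg) = false by rewrite /b; lia.
      by rewrite M0E -?lt0n.
- by lia.
Qed.

Lemma epilogue_ok M S : cell M Output 0 <= S ->
    (forall i, nreg <= i -> bitlen (M i) <= S) ->
  runs epilogue M (epilogue_cost S)
    (fun M1 => output M1 =
       [seq cell M Output (pos (cell M Output 0) i) | i <- iota 1 (cell M Output 0)]).
Proof.
move=> LS bM; have n40 := nreg_large.
have bl x : bitlen x <= x.+1 by apply: bitlen_leqS.
have [L LE] : exists L, L = cell M Output 0 by eexists.
rewrite -LE in LS *; have [top topE] : exists top, top = L + 2 * nreg by eexists.
have bn := bl nreg; have bL := bl L; have bt := bl top.
have bLn := bl (L + nreg); have b2n := bl (2 * nreg).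
apply: (@runs_step _ _ _ (nreg + 7 + S + 1) ((2 + nreg.+1) + ((20 * nreg + 5 * S + 20)
    + ((S + nreg).+1 * (2 + (S + nreg).+1 + transfer_cost S + 1)
    + ((20 * nreg + 5 * S + 20) + (nreg * (2 * S + 6 * (S + 2 * nreg) + 20)
    + (20 * nreg + 5 * S + 20))))))) => //=.
  have := bl (nreg + 3); have := bM (nreg + 3) (leq_addr _ _).
  by rewrite /= !addn0 bitlen0; lia.
rewrite -[M _]/(cell M Output 0) -LE; set M0 := write _ _ _.
have M0E i : i != 0 -> M0 i = M i by move=> i0; apply: write_other.
apply: (@runs_step _ _ _ (2 + nreg.+1) ((20 * nreg + 5 * S + 20)
    + ((S + nreg).+1 * (2 + (S + nreg).+1 + transfer_cost S + 1)
    + ((20 * nreg + 5 * S + 20) + (nreg * (2 * S + 6 * (S + 2 * nreg) + 20)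
    + (20 * nreg + 5 * S + 20)))))) => //=.
set M1 := write _ _ _.
have M10 : M1 0 = L by [].
apply: (@runs_step _ _ _ (20 * nreg + 5 * S + 20)
    ((S + nreg).+1 * (2 + (S + nreg).+1 + transfer_cost S + 1)
    + ((20 * nreg + 5 * S + 20) + (nreg * (2 * S + 6 * (S + 2 * nreg) + 20)
    + (20 * nreg + 5 * S + 20))))) => //=.
  by rewrite M10 bitlen0 bitlen2; lia.
rewrite M10; set M2 := write _ _ _.
have M2E i : 2 < i -> M2 i = M i.
  by move=> i2; rewrite /M2 /M1 !write_other ?M0E //; lia.
pose src p := nreg + 4 * p + Output.
pose Inv q M3 := [/\ M3 2 = q, M3 0 = L, M3 1 + q = top,
  forall p, nreg < p -> p + q <= top -> M3 p = M (src p) &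
  forall p, p <= top -> top < p + q -> M3 (src p) = M (src p)].
have Inv2 : Inv (L + nreg) M2.
  split=> //.
  - by rewrite topE -[M2 1]/nreg; lia.
  - by move=> p; rewrite topE; lia.
apply: (runs_seq (B1 := (S + nreg).+1 * (2 + (S + nreg).+1 + transfer_cost S + 1))
    (B2 := (20 * nreg + 5 * S + 20) + (nreg * (2 * S + 6 * (S + 2 * nreg) + 20)
    + (20 * nreg + 5 * S + 20))) (Q1 := Inv 0)) => //.
- apply: runs_le (runs_while (B := transfer_cost S) _ _ Inv2) _.
  + by move=> q M3 _ [].
  + move=> q M3 lt_q [M32 M30 M31 M3lo M3hi].
    have [p pE] : exists p, M3 1 = p by eexists.
    have bp := bl p; have bp1 := bl p.+1; have bq := bl q; have bq1 := bl q.+1.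
    rewrite pE in M31; have p_n : nreg <= p by lia.
    apply: (runs_step (B1 := 2 * p + 20) (B2 := transfer_cost S - (2 * p + 20))) => //=.
    * by rewrite pE addn1 bitlen1; lia.
    * rewrite pE addn1; apply: (runs_step (B1 := p + 10)
        (B2 := transfer_cost S - (3 * p + 30))) => //=.
      - by rewrite write_same bitlen1 bitlen3; lia.
      - rewrite write_same; set M4 := write _ _ _.
        have M43 : M4 3 = p.+1 by [].
        have M4E i : i != 1 -> i != 3 -> M4 i = M3 i.
          by move=> i1 i3; rewrite /M4 !write_other.
        have b3 : bitlen (M4 3) <= p.+2 by rewrite M43.
        apply: (runs_seq (B2 := transfer_cost S - (8 * nreg + 7 * p + 50))
            (locate_ok Output _ b3)) => //.
        + move=> M5 []; rewrite M43 -/(src p.+1) => M53 bM5 M5E.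
          have M51 : M5 1 = p.+1 by rewrite M5E.
          have M52 : M5 2 = q.+1 by rewrite M5E ?M4E.
          have M5s : M5 (src p.+1) = M (src p.+1).
            by rewrite M5E ?M4E ?M3hi //; rewrite /src /=; lia.
          apply: (runs_step (B1 := S + nreg + 3 * p + 40) (B2 := 2 * q + 20)) => //=.
          * rewrite M51 M53 M5s bitlen1 bitlen3; rewrite M53 in bM5.
            have : bitlen (M (src p.+1)) <= S by apply: bM; rewrite /src -addnA leq_addr.
            by lia.
          * rewrite M51 M53 M5s; set M6 := write _ _ _.
            have M62 : M6 2 = q.+1 by rewrite /M6 write_other ?M52 //; lia.
            apply: runs_basic => //=; rewrite M62 subSS subn0 ?bitlen1 ?bitlen2.
              by lia.
            have M6E i : 3 < i -> i != p.+1 -> M6 i = M3 i.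
              by move=> ? ne; rewrite /M6 write_other // M5E ?M4E //; lia.
            split.
            + by [].
            + by rewrite write_other // /M6 write_other // M5E ?M4E.
            + by rewrite write_other // /M6 write_other ?M51; lia.
            + move=> i lt_i le_i; rewrite write_other; last by lia.
              case: (eqVneq i p.+1) => [->|ne_i]; first by rewrite /M6 write_same.
              by rewrite M6E ?M3lo //; lia.
            + move=> i le_i lt_i; have ? : p < i by lia.
              by rewrite write_other ?M6E ?M3hi //; rewrite /src /=; lia.
          * by rewrite /transfer_cost; lia.
        + by rewrite /transfer_cost; lia.
      - by rewrite /transfer_cost; lia.
    * by rewrite /transfer_cost; lia.
  + by rewrite bitlen2; apply: leq_mul; lia.
- move=> M3 [M32 M30 M31 M3lo _].
  apply: (@runs_step _ _ _ (20 * nreg + 5 * S + 20)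
    (nreg * (2 * S + 6 * (S + 2 * nreg) + 20) + (20 * nreg + 5 * S + 20))) => //=.
    by rewrite M30 bitlen0; lia.
  rewrite M30; set M4 := write _ _ _.
  have M40 : M4 0 = L + nreg by [].
  have M4E i : i != 0 -> M4 i = M3 i by move=> i0; rewrite /M4 write_other.
  apply: (runs_seq (B1 := nreg * (2 * S + 6 * (S + 2 * nreg) + 20))
    (B2 := 20 * nreg + 5 * S + 20)) => //.
    apply: runs_le (restore_regs_ok (S := S) M40 (leq_addl _ _) _) _.
      move=> i lt_i; rewrite M4E ?M3lo; try by lia.
      by apply: bM; rewrite /src -addnA leq_addr.
    by rewrite leq_mul2l; lia.
  move=> M5 []; rewrite -addnA addnn -mul2n -topE => M50 M5E.
  apply: runs_basic => //=.
    by rewrite M50 bitlen0; have := bl (top - 2 * nreg); lia.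
  rewrite /output write_same M50 topE addnK; apply/eq_in_map => i.
  rewrite mem_iota => lt_i; rewrite write_other ?M5E; try by lia.
  rewrite /pos; case: leqP => le_i; rewrite M4E ?M3lo //; lia.
Qed.

(** * Polynomial time *)

Definition poly_bounded (f : nat -> nat) :=
  exists p : {poly nat}, forall s, f s <= p.[s]%R.

Lemma poly_bounded_cst a : poly_bounded (fun=> a).
Proof. by exists (a%:P)%R => s; rewrite hornerC. Qed.

Lemma poly_bounded_id : poly_bounded id.
Proof. by exists 'X%R => s; rewrite hornerX. Qed.

Lemma poly_boundedD f g :
  poly_bounded f -> poly_bounded g -> poly_bounded (fun s => f s + g s).
Proof.
by move=> [p le_p] [q le_q]; exists (p + q)%R => s; rewrite hornerD leq_add.
Qed.

Lemma poly_boundedS f : poly_bounded f -> poly_bounded (fun s => (f s).+1).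
Proof.
move=> pf; have [p le_p] := poly_boundedD pf (poly_bounded_cst 1).
by exists p => s; rewrite -addn1.
Qed.

Lemma poly_boundedM f g :
  poly_bounded f -> poly_bounded g -> poly_bounded (fun s => f s * g s).
Proof.
by move=> [p le_p] [q le_q]; exists (p * q)%R => s; rewrite hornerM leq_mul.
Qed.

Ltac poly_bound :=
  lazymatch goal with
  | |- poly_bounded (fun s => @?f s + @?g s) =>
      apply: (@poly_boundedD f g); poly_bound
  | |- poly_bounded (fun s => @?f s * @?g s) =>
      apply: (@poly_boundedM f g); poly_bound
  | |- _ => first [ assumption | exact: poly_bounded_cst | exact: poly_bounded_id
                  | apply: poly_boundedS; poly_bound ]
  end.

Lemma expr_cost_poly e : poly_bounded (expr_cost e).
Proof. by elim: e => [c|x|op e1 IH1 e2 IH2|a e IH|x e IH] /=; poly_bound. Qed.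

Lemma cmd_cost_poly c : poly_bounded (cmd_cost c).
Proof.
elim: c => [a e v|c1 IH1 c2 IH2|e c IH|x c IH] /=; try poly_bound.
  by have := expr_cost_poly e; have := expr_cost_poly v; move=> *; poly_bound.
by have := expr_cost_poly e; move=> *; poly_bound.
Qed.

Lemma prologue_cost_poly : poly_bounded prologue_cost.
Proof. by rewrite /prologue_cost /transfer_cost; poly_bound. Qed.

Lemma epilogue_cost_poly : poly_bounded epilogue_cost.
Proof. by rewrite /epilogue_cost /transfer_cost; poly_bound. Qed.

Lemma size_bitsize s : size s <= bitsize s.
Proof. by rewrite -sum1_size /bitsize leq_sum. Qed.

Lemma bitlen_load s i : bitlen (load s i) <= (bitsize s).+1.
Proof.
case: i => [|i]; first by rewrite /load /= (leq_trans (bitlen_leqS _)) // ltnS size_bitsize.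
rewrite /load /=; case: (ltnP i (size s)) => [lt_i|le_i]; last by rewrite nth_default.
apply: leqW; rewrite /bitsize (big_nth 0) big_mkord (bigD1 (Ordinal lt_i)) //=.
exact: leq_addr.
Qed.

(** All variables are initially mapped to register 0, which holds the size of the input; [Var 0],
    bound by no loop of the solver, therefore denotes the loop bound. *)
Definition ram_program (c : cmd) : program :=
  assemble 0 (RSeq prologue (RSeq (compile_cmd (fun=> 0) 1 c) epilogue)).

(** Only the input cells of [H0] are specified. The other arrays start with whatever relocation left
    there, so a program has to initialise what it reads. *)
Lemma ram_programP c : cmd_regs c < nreg -> bounded_stores c ->
  exists p : {poly nat}, forall s : seq nat, exists H0 : store,
    (forall i, 0 < i <= size s -> H0 Input (pos (size s) i) = load s i) /\
    let H := run (size s) (fun=> size s) c H0 in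
    (H Output 0 <= size s ->
     exists time M, [/\ exec (ram_program c) 0 (load s) time M,
       time <= p.[bitsize s]%R &
       output M = [seq H Output (pos (H Output 0) i) | i <- iota 1 (H Output 0)]]).
Proof.
move=> regs st; pose cost S := prologue_cost S + (cmd_cost c S + epilogue_cost S).
have [p le_p] : poly_bounded cost.
  have := prologue_cost_poly; have := epilogue_cost_poly; have := cmd_cost_poly c.
  by move=> *; rewrite /cost; poly_bound.
(* The cost is taken at [bitsize s + 1], since register 0 holds the length of [s], which is not an
   item and may need one bit more than [bitsize s]. *)
exists (p \Po ('X + 1))%R => s; set S := (bitsize s).+1.
have le_s : size s <= S by apply: leqW; apply: size_bitsize.
have [k1 [M1 [ev1 le1 [M10 bM1 M1in]]]] := prologue_ok le_s (bitlen_load s).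
exists (cell M1); split=> //.
have b0 : bitlen (M1 0) <= S by rewrite M10; apply: (bitlen_load s 0).
have val : valuation (fun=> 0) 1 M1 (fun=> size s) by rewrite /valuation M10.
have LS : M1 0 <= S by rewrite M10.
have [k2 [M2 [ev2 le2 [M2E bM2 cM2]]]] :=
  compile_cmd_ok (ltn0Sn 0) regs st (conj b0 bM1) LS val.
rewrite M10 in cM2; rewrite -cM2 => /= L_le.
have [k3 [M3 [ev3 le3 out3]]] := epilogue_ok (leq_trans L_le le_s) bM2.2.
exists (k1 + (k2 + k3)), M3; split=> //.
  by apply: reval_program; apply: EvSeq ev1 _; apply: EvSeq ev2 ev3.
have := leq_trans (leq_add le1 (leq_add le2 le3)) (le_p S).
by rewrite horner_comp !hornerE /GRing.add /= addn1.
Qed.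

(** * The algorithm *)

(** Truth values are the numbers 0 and 1; truncated subtraction provides both negation and
    comparison. *)
Definition ENot e := Bin Defs.Sub (Lit 1) e.
Definition EAnd e1 e2 := Bin Mul e1 e2.
Definition EOr e1 e2 := ENot (EAnd (ENot e1) (ENot e2)).
Definition EImp e1 e2 := ENot (EAnd e1 (ENot e2)).
Definition ELe e1 e2 := ENot (Bin Defs.Sub e1 e2).
Definition ELt e1 e2 := ENot (ELe e2 e1).
Definition EEq e1 e2 := EAnd (ELe e1 e2) (ELe e2 e1).
Definition EAll x e := ENot (Sum x (ENot e)).
Definition EIte c e1 e2 := Bin Add (Bin Mul c e1) (Bin Mul (ENot c) e2).

Section Eval.

Variables (L : nat) (H : store).

(** Evaluation as a relation: the value of a large expression is found by following its syntax,
    without ever unfolding it. *)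
Definition evals V e (v : nat) := eval L H V e = v.
Definition holds V e (b : bool) := evals V e b.

Lemma evals_lit V c : evals V (Lit c) c. Proof. by []. Qed.

Lemma evals_bool V e (b : bool) : holds V e b -> evals V e b. Proof. by []. Qed.

Lemma evals_add V e1 e2 v1 v2 :
  evals V e1 v1 -> evals V e2 v2 -> evals V (Bin Add e1 e2) (v1 + v2).
Proof. by rewrite /evals /= => -> ->. Qed.

Lemma evals_sub V e1 e2 v1 v2 :
  evals V e1 v1 -> evals V e2 v2 -> evals V (Bin Defs.Sub e1 e2) (v1 - v2).
Proof. by rewrite /evals /= => -> ->. Qed.

Lemma evals_mul V e1 e2 v1 v2 :
  evals V e1 v1 -> evals V e2 v2 -> evals V (Bin Mul e1 e2) (v1 * v2).
Proof. by rewrite /evals /= => -> ->. Qed.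

Lemma evals_get V a e v : evals V e v -> evals V (Get a e) (H a v).
Proof. by rewrite /evals /= => ->. Qed.

Lemma evals_sum V x e F : (forall i, 0 < i <= L -> evals (upd V x i) e (F i)) ->
  evals V (Sum x e) (\sum_(1 <= i < L.+1) F i).
Proof. by rewrite /evals /= => eF; apply: eq_big_nat. Qed.

Lemma holds_not V e b : holds V e b -> holds V (ENot e) (~~ b).
Proof. by rewrite /holds /evals /= => ->; case: b. Qed.

Lemma holds_and V e1 e2 b1 b2 :
  holds V e1 b1 -> holds V e2 b2 -> holds V (EAnd e1 e2) (b1 && b2).
Proof. by rewrite /holds /evals /= => -> ->; rewrite mulnb. Qed.

Lemma holds_or V e1 e2 b1 b2 :
  holds V e1 b1 -> holds V e2 b2 -> holds V (EOr e1 e2) (b1 || b2).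
Proof.
by move=> h1 h2; rewrite -[b1 || b2]negbK negb_or; do ?apply: holds_not;
  apply: holds_and; apply: holds_not.
Qed.

Lemma holds_imp V e1 e2 b1 b2 :
  holds V e1 b1 -> holds V e2 b2 -> holds V (EImp e1 e2) (b1 ==> b2).
Proof.
move=> h1 h2; rewrite implybE -[~~ b1 || b2]negbK negb_or negbK.
by apply: holds_not; apply: holds_and => //; apply: holds_not.
Qed.

Lemma holds_le V e1 e2 v1 v2 :
  evals V e1 v1 -> evals V e2 v2 -> holds V (ELe e1 e2) (v1 <= v2).
Proof. by rewrite /holds /evals /= => -> ->; rewrite -subn_eq0; case: (v1 - v2). Qed.

Lemma holds_lt V e1 e2 v1 v2 :
  evals V e1 v1 -> evals V e2 v2 -> holds V (ELt e1 e2) (v1 < v2).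
Proof. by move=> h1 h2; rewrite ltnNge; apply/holds_not/holds_le. Qed.

Lemma holds_eq V e1 e2 v1 v2 :
  evals V e1 v1 -> evals V e2 v2 -> holds V (EEq e1 e2) (v1 == v2).
Proof. by move=> h1 h2; rewrite eqn_leq; apply: holds_and; apply: holds_le. Qed.

Lemma holds_all V x e p :
    (forall i, 0 < i <= L -> holds (upd V x i) e (p i)) ->
  holds V (EAll x e) (all p (iota 1 L)).
Proof.
move=> ep; rewrite /holds /evals /=.
rewrite (_ : \sum_(_ <= i < _) _ = \sum_(1 <= i < L.+1) ~~ p i); last first.
  by apply: eq_big_nat => i /ep; rewrite /holds /evals => ->; case: (p i).
rewrite /index_iota subn1 /=; elim: (iota 1 L) => [|i r IH]; first by rewrite big_nil.
by rewrite big_cons /=; case: (p i).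
Qed.

Lemma evals_ite V e e1 e2 b v1 v2 :
    holds V e b -> evals V e1 v1 -> evals V e2 v2 ->
  evals V (EIte e e1 e2) (if b then v1 else v2).
Proof.
by rewrite /holds /evals /= => -> -> ->; case: b; rewrite mul1n mul0n ?addn0.
Qed.

Lemma evals_var V x v : V x = v -> evals V (Var x) v. Proof. by []. Qed.

End Eval.

(* The courses are the nodes [1 .. n], the TAs the nodes [n+1 .. n+m]; items of
   the input are numbered from 1. *)
Definition posE el e := EIte (ELe e (Lit nreg)) (Bin Add (Bin Add el (Lit nreg)) e) e.

Definition itemE e :=
  Bin Mul (EAnd (ELt (Lit 0) e) (ELe e (Var 0))) (Get Input (posE (Var 0) e)).

Definition nE := itemE (Lit 1).
Definition mE := itemE (Lit 2).

(** Item 5 is the first after the two dimensions and the two parts of the threshold. A TA's block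
    has [1 + 3 * n] items: its length prefix at offset 0, the utility for course [a] at offset [a],
    and the grade for [a] at offsets [n + 2 * a - 1] and [n + 2 * a]. A course's block has its
    capacity at offset 0. *)
Definition rowE b :=
  Bin Add (Lit 5) (Bin Mul (Bin Defs.Sub b (Bin Add nE (Lit 1)))
                           (Bin Add (Lit 1) (Bin Mul (Lit 3) nE))).
Definition crowE a :=
  Bin Add (Bin Add (Lit 5) (Bin Mul mE (Bin Add (Lit 1) (Bin Mul (Lit 3) nE))))
    (Bin Mul (Bin Defs.Sub a (Lit 1)) (Bin Add (Lit 1) mE)).
Definition utilE b a := itemE (Bin Add (rowE b) a).
Definition numE b a :=
  itemE (Bin Defs.Sub (Bin Add (Bin Add (rowE b) nE) (Bin Mul (Lit 2) a)) (Lit 1)).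
Definition denE b a := itemE (Bin Add (Bin Add (rowE b) nE) (Bin Mul (Lit 2) a)).
Definition capE a := itemE (crowE a).
Definition valE a b := itemE (Bin Add (crowE a) (Bin Defs.Sub b nE)).

Definition is_courseE a := EAnd (ELt (Lit 0) a) (ELe a nE).
Definition is_taE b := EAnd (ELt nE b) (ELe b (Bin Add nE mE)).
Definition edgeE a b := EAnd (is_courseE a) (EAnd (is_taE b) (ELt (Lit 0) (utilE b a))).
Definition adjE a b := EOr (edgeE a b) (edgeE b a).

Definition othersE v b := EAnd (is_taE b) (ENot (EEq b v)).

Definition course_okE a v :=
  EAnd (EEq (Sum 7 (EAnd (othersE v (Var 7)) (ELt (Lit 0) (utilE (Var 7) a)))) (capE a))
       (ELe (Bin Mul (itemE (Lit 3)) (capE a))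
            (Bin Mul (itemE (Lit 4))
               (Sum 7 (Bin Mul (othersE v (Var 7)) (valE a (Var 7)))))).

Definition ta_okE a v :=
  EAll 6 (EAll 7 (EImp
    (EAnd (edgeE (Var 6) (Var 7)) (EAnd (ENot (EEq (Var 7) a))
       (ELe (Bin Mul (numE (Var 7) (Var 6)) (denE a (Var 6)))
            (Bin Mul (numE a (Var 6)) (denE (Var 7) (Var 6))))))
    (ELe (utilE a (Var 6)) (Bin Mul (ENot (EEq v a)) (utilE a v))))).

Definition allowedE a v :=
  EAnd (EOr (EEq v a) (adjE a v))
    (EOr (EAnd (is_courseE a) (course_okE a v)) (EAnd (is_taE a) (ta_okE a v))).

Definition vS := 1. Definition vV := 2. Definition vR := 3.
Definition vA := 4. Definition vB := 5.
Definition clear_trial := For vA (Store Trial (Var vA) (Lit 0)).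
(* A decided node [a] that does not point to its neighbour [b] forces [b] to point
   to [a]. *)
Definition propagate_step :=
  If (EAnd (adjE (Var vA) (Var vB))
       (EAnd (ENot (EEq (Get Trial (Var vA)) (Lit 0)))
             (ENot (EEq (Get Trial (Var vA)) (Var vB)))))
     (Store Trial (Var vB) (Var vA)).
Definition propagate := For vR (For vA (For vB propagate_step)).
(* The decided nodes form a union of connected components, on which [Trial] is a
   solution. *)
Definition trial_okE :=
  EAll vA (EImp (ELt (Lit 0) (Get Trial (Var vA)))
    (EAnd (allowedE (Var vA) (Get Trial (Var vA)))
      (EAll vB (EImp (adjE (Var vA) (Var vB))
        (EAnd (ELt (Lit 0) (Get Trial (Var vB)))
          (ENot (EEq (EEq (Get Trial (Var vA)) (Var vB))
                     (EEq (Get Trial (Var vB)) (Var vA))))))))).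
Definition keep_trial :=
  For vA (If (ELt (Lit 0) (Get Trial (Var vA)))
             (Store Kept (Var vA) (Get Trial (Var vA)))).
Definition try_seed :=
  Seq (Seq (Seq clear_trial (Store Trial (Var vS) (Var vV))) propagate)
      (If trial_okE keep_trial).
Definition search := For vS (For vV try_seed).
Definition kept_allE :=
  EAll vA (EImp (ELe (Var vA) (Bin Add nE mE)) (ELt (Lit 0) (Get Kept (Var vA)))).
Definition out_posE e := posE (Bin Add mE (Lit 1)) e.
Definition write_item :=
  If (is_taE (Var vA))
    (Seq (Store Output (out_posE (Bin Add (Bin Defs.Sub (Var vA) nE) (Lit 1))) (Lit 0))
      (If (ELe (Get Kept (Var vA)) nE)
        (Store Output (out_posE (Bin Add (Bin Defs.Sub (Var vA) nE) (Lit 1)))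
          (Get Kept (Var vA))))).
(** The length [m + 1] cannot be stored directly, as stores take no arithmetic; the first loop waits
    until its variable equals it. *)
Definition write_answer :=
  Seq (For vA (If (EEq (Var vA) (Bin Add mE (Lit 1))) (Store Output (Lit 0) (Var vA))))
    (Seq (Store Output (out_posE (Lit 1)) (Lit 1)) (For vA write_item)).
Definition mefe_solver :=
  Seq (For vA (Store Kept (Var vA) (Lit 0)))
    (Seq search
      (Seq (Store Output (Lit 0) (Lit 1))
        (Seq (Store Output (Lit (pos 1 1)) (Lit 0)) (If kept_allE write_answer)))).


(** * Correctness of the algorithm *)

(** Iteration [i] establishes its own fact [Q i], which the later iterations must not undo. The
    nested loops of the solver are handled by nesting this rule. *)
Lemma downfrom_all (T : Type) (P : T -> Prop) (Q : nat -> T -> Prop) f k t :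
    P t -> (forall i u, 0 < i <= k -> P u -> P (f i u)) ->
    (forall i u, 0 < i <= k -> P u -> Q i (f i u)) ->
    (forall i j u, 0 < i <= k -> 0 < j <= k -> P u -> Q i u -> Q i (f j u)) ->
  P (downfrom f k t) /\ forall i, 0 < i <= k -> Q i (downfrom f k t).
Proof.
move=> Pt fP fQ QQ.
suff: forall j u, j <= k -> P u -> (forall i, j < i <= k -> Q i u) ->
    P (downfrom f j u) /\ forall i, 0 < i <= k -> Q i (downfrom f j u).
  by apply=> // i; rewrite ltnNge; case: (i <= k).
elim=> [|j IH] u le_j Pu Qu //=; apply: IH; first exact: ltnW.
  exact: fP.
move=> i /andP[]; rewrite leq_eqVlt => /predU1P[<- _|lt_ji le_i].
  exact: fQ.
by apply: QQ => //; [rewrite (leq_trans _ lt_ji) | apply: Qu; rewrite lt_ji].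
Qed.

Lemma downfrom_inv (T : Type) (P : T -> Prop) f k t :
  P t -> (forall i u, 0 < i <= k -> P u -> P (f i u)) -> P (downfrom f k t).
Proof. by move=> Pt fP; case: (downfrom_all (Q := fun _ _ => True) Pt fP). Qed.

Lemma downfrom_each (T : Type) (P : T -> Prop) (Q : nat -> T -> Prop) f k t :
    P t -> (forall i u, 0 < i <= k -> P u -> P (f i u) /\ Q i (f i u)) ->
    (forall i j u, 0 < i <= k -> 0 < j <= k -> P u -> Q i u -> Q i (f j u)) ->
  P (downfrom f k t) /\ forall i, 0 < i <= k -> Q i (downfrom f k t).
Proof.
by move=> Pt fPQ; apply: downfrom_all => // i u lt_i Pu; case: (fPQ i u lt_i Pu).
Qed.

Fixpoint stores_to (a : array) (c : cmd) : bool :=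
  match c with
  | Store a' _ _ => a == a' :> nat
  | Seq c1 c2 => stores_to a c1 || stores_to a c2
  | If _ c1 | For _ c1 => stores_to a c1
  end.

Lemma run_frame L V c H a : ~~ stores_to a c -> run L V c H a = H a.
Proof.
elim: c V H => [a' e v|c1 IH1 c2 IH2|e c IH|x c IH] V H /=.
- by move=> /negPf ne_a; apply: functional_extensionality => i; rewrite /set_cell ne_a.
- by rewrite negb_or => /andP[c1a c2a]; rewrite IH2 ?IH1.
- by case: eqP => // _ ca; rewrite IH.
- by move=> ca; apply: (@downfrom_inv _ (fun H1 => H1 a = H a)) => // i H1 _ <-; rewrite IH.
Qed.

(** * Orbits of a self-map of finitely many nodes *)

Section Orbits.

Variables (N : nat) (D : nat -> nat).
Hypothesis D_node : forall a, 0 < a <= N -> 0 < D a <= N.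

Lemma iter_node a k : 0 < a <= N -> 0 < iter k D a <= N.
Proof. by move=> a_n; elim: k => //= k; apply: D_node. Qed.

Lemma uniq_traject_node a k : 0 < a <= N -> uniq (traject D a k) -> k <= N.
Proof.
move=> a_n /uniq_leq_size le_k; have := le_k (iota 1 N).
rewrite size_traject size_iota; apply=> _ /trajectP[i _ ->].
by rewrite mem_iota add1n ltnS iter_node.
Qed.

Lemma periodic_point a : 0 < a <= N ->
  exists i p, 0 < p /\ iter p D (iter i D a) = iter i D a.
Proof.
move=> a_n; have /trajectP[i lt_i eq_i] : looping D a N.
  apply: contraT; rewrite -looping_uniq => /(uniq_traject_node a_n).
  by rewrite ltnn.
exists i, (N - i); rewrite subn_gt0 lt_i; split=> //.
by rewrite -iterD subnK 1?ltnW.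
Qed.

(** A shortest path to [t] visits no node twice. This is why as many rounds of propagation as there
    are items suffice. *)
Lemma short_path a k t : 0 < a <= N -> iter k D a = t ->
  exists2 j, j <= N & iter j D a = t.
Proof.
move=> a_n def_t; have ex : exists k, iter k D a == t by exists k; apply/eqP.
case: (ex_minnP ex) => j /eqP def_j min_j; exists j => //.
apply: ltnW; apply: (uniq_traject_node a_n).
rewrite looping_uniq; apply/trajectP => -[i lt_i eq_i].
by have := min_j i; rewrite -eq_i def_j eqxx leqNgt lt_i => /(_ isT).
Qed.

End Orbits.

(** * The predicates that the expressions compute *)

Section Semantics.

Variable s : seq nat.
Let L := size s.

(** Reading out of range gives 0, and not what the memory happens to contain, so that all predicates
    depend on [s] alone. *)
Definition item i := if 0 < i <= L then load s i else 0.

Let n := item 1.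
Let m := item 2.
Definition ta_row b := 5 + (b - (n + 1)) * (1 + 3 * n).
Definition course_row a := 5 + m * (1 + 3 * n) + (a - 1) * (1 + m).
Definition util_of b a := item (ta_row b + a).
Definition num_of b a := item (ta_row b + n + 2 * a - 1).
Definition den_of b a := item (ta_row b + n + 2 * a).
Definition cap_of a := item (course_row a).
Definition val_of a b := item (course_row a + (b - n)).

Definition is_course a := 0 < a <= n.
Definition is_ta b := n < b <= n + m.
Definition edge a b := [&& is_course a, is_ta b & 0 < util_of b a].
Definition adj a b := edge a b || edge b a.
Definition others v b := is_ta b && (b != v).

(* Course [a] takes the TAs that it values, except [v]. *)
Definition course_ok a v :=
  (\sum_(1 <= b < L.+1) (others v b && (0 < util_of b a)) == cap_of a) &&
  (item 3 * cap_of a <= item 4 * \sum_(1 <= b < L.+1) others v b * val_of a b).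

(* Envy can be tested without knowing the matching: if TA [a] is left out by course
   [x], then [x] takes all the other TAs that it values. *)
Definition ta_ok a v :=
  all (fun x => all (fun j =>
    edge x j && ((j != a) && (num_of j x * den_of a x <= num_of a x * den_of j x))
      ==> (util_of a x <= (v != a) * util_of a v)) (iota 1 L)) (iota 1 L).

Definition allowed a v :=
  ((v == a) || adj a v) && (is_course a && course_ok a v || is_ta a && ta_ok a v).

Definition trial_ok (T : nat -> nat) :=
  all (fun a => (0 < T a) ==> allowed a (T a) &&
    all (fun b => adj a b ==> (0 < T b) &&
          ((T a == b :> nat) != (T b == a) :> nat)) (iota 1 L)) (iota 1 L).

Definition kept_all (T : nat -> nat) :=
  all (fun a => (a <= n + m) ==> (0 < T a)) (iota 1 L).

Definition input_ok (H : store) :=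
  forall i, 0 < i <= L -> H Input (pos L i) = load s i.

Section Input.

Variables (H : store) (V : nat -> nat).
Hypotheses (H_ok : input_ok H) (V0 : V 0 = L).
Local Notation evals := (evals L H).
Local Notation holds := (holds L H).

Lemma evals_pos el e l i :
  evals V el l -> evals V e i -> evals V (posE el e) (pos l i).
Proof.
move=> hl he; apply: evals_ite => //; first exact: holds_le.
by do 2!apply: evals_add => //.
Qed.

Lemma evals_item e i : evals V e i -> evals V (itemE e) (item i).
Proof.
move=> he; have h0 : evals V (Var 0) L by [].
have hb : holds V (EAnd (ELt (Lit 0) e) (ELe e (Var 0))) (0 < i <= L).
  by apply: holds_and; [apply: holds_lt | apply: holds_le].
have := evals_mul (evals_bool hb) (evals_get Input (evals_pos h0 he)).
by rewrite /item /evals => ->; case: ifP => [/H_ok->|_]; rewrite ?mul1n ?mul0n.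
Qed.

Lemma evals_n : evals V nE n. Proof. exact: evals_item. Qed.
Lemma evals_m : evals V mE m. Proof. exact: evals_item. Qed.

End Input.

Ltac ev := try assumption;
  lazymatch goal with
  | |- holds _ _ _ (ELe _ _) _ => apply: holds_le; ev
  | |- holds _ _ _ (ELt _ _) _ => apply: holds_lt; ev
  | |- holds _ _ _ (EEq _ _) _ => apply: holds_eq; ev
  | |- holds _ _ _ (ENot _) _ => apply: holds_not; ev
  | |- holds _ _ _ (EAnd _ _) _ => apply: holds_and; ev
  | |- evals _ _ _ (Lit _) _ => exact: evals_lit
  | |- evals _ _ _ (Var _) _ => exact: evals_var
  | |- evals _ _ _ nE _ => exact: evals_n
  | |- evals _ _ _ mE _ => exact: evals_m
  | |- evals _ _ _ (itemE _) _ => apply: evals_item; ev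
  | |- evals _ _ _ (posE _ _) _ => apply: evals_pos; ev
  | |- evals _ _ _ (Bin Add _ _) _ => apply: evals_add; ev
  | |- evals _ _ _ (Bin Defs.Sub _ _) _ => apply: evals_sub; ev
  | |- evals _ _ _ (Bin Mul _ _) _ => apply: evals_mul; ev
  | |- evals _ _ _ (Get _ _) _ => apply: evals_get; ev
  | |- _ => idtac
  end.

Section Graph.

Variables (H : store) (V : nat -> nat) (ea eb : expr) (a b : nat).
Hypotheses (H_ok : input_ok H) (V0 : V 0 = L).
Hypotheses (ea_a : evals L H V ea a) (eb_b : evals L H V eb b).
Local Notation evals := (evals L H V).
Local Notation holds := (holds L H V).

Lemma evals_row : evals (rowE eb) (ta_row b). Proof. by rewrite /rowE; ev. Qed.
Lemma evals_crow : evals (crowE ea) (course_row a). Proof. by rewrite /crowE; ev. Qed.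
Let row_b := evals_row.
Let crow_a := evals_crow.
Lemma evals_util : evals (utilE eb ea) (util_of b a). Proof. by rewrite /utilE; ev. Qed.
Lemma evals_num : evals (numE eb ea) (num_of b a). Proof. by rewrite /numE; ev. Qed.
Lemma evals_den : evals (denE eb ea) (den_of b a). Proof. by rewrite /denE; ev. Qed.
Lemma evals_cap : evals (capE ea) (cap_of a). Proof. by rewrite /capE; ev. Qed.
Lemma evals_val : evals (valE ea eb) (val_of a b). Proof. by rewrite /valE; ev. Qed.

Lemma holds_course : holds (is_courseE ea) (is_course a).
Proof. by apply: holds_and; ev. Qed.
Lemma holds_ta : holds (is_taE eb) (is_ta b).
Proof. by apply: holds_and; ev. Qed.
Lemma holds_edge : holds (edgeE ea eb) (edge a b).
Proof.
apply: holds_and holds_course (holds_and holds_ta _).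
by apply: holds_lt evals_util.
Qed.

End Graph.

Lemma holds_adj H V ea eb a b : input_ok H -> V 0 = L ->
  evals L H V ea a -> evals L H V eb b -> holds L H V (adjE ea eb) (adj a b).
Proof. by move=> *; apply: holds_or; apply: holds_edge. Qed.

Lemma holds_course_ok H V a : input_ok H -> V 0 = L -> V vA = a ->
  holds L H V (course_okE (Var vA) (Get Trial (Var vA))) (course_ok a (H Trial a)).
Proof.
move=> H_ok V0 Va; apply: holds_and.
  apply: holds_eq; last by apply: evals_cap.
  apply: evals_sum => i _; apply/evals_bool/holds_and.
    apply: holds_and; first by apply: holds_ta.
    by apply/holds_not; ev; rewrite /evals /= Va.
  apply: holds_lt => //; apply: evals_util => //.
apply: holds_le.
  apply: evals_mul; first by apply: evals_item.
  by apply: evals_cap.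
apply: evals_mul; first by apply: evals_item.
apply: evals_sum => i _; apply: evals_mul.
  apply/evals_bool/holds_and; first by apply: holds_ta.
  by apply/holds_not; ev; rewrite /evals /= Va.
by apply: evals_val.
Qed.

Lemma holds_ta_ok H V a : input_ok H -> V 0 = L -> V vA = a ->
  holds L H V (ta_okE (Var vA) (Get Trial (Var vA))) (ta_ok a (H Trial a)).
Proof.
move=> H_ok V0 Va; apply: holds_all => x _; apply: holds_all => j _.
have hT W : W vA = a -> evals L H W (Get Trial (Var vA)) (H Trial a).
  by move=> Wa; apply: evals_get.
apply: holds_imp; [apply: holds_and; last apply: holds_and|].
- exact: holds_edge.
- by apply: holds_not; ev.
- by apply: holds_le; apply: evals_mul; (apply: evals_num || apply: evals_den).
- apply: holds_le; first by apply: evals_util.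
  apply: evals_mul; first by apply/evals_bool/holds_not/holds_eq; [apply: hT|].
  by apply: evals_util => //; apply: hT.
Qed.

Lemma holds_allowed H V a : input_ok H -> V 0 = L -> V vA = a ->
  holds L H V (allowedE (Var vA) (Get Trial (Var vA))) (allowed a (H Trial a)).
Proof.
move=> H_ok V0 Va; have hT : evals L H V (Get Trial (Var vA)) (H Trial a).
  exact: evals_get.
apply: holds_and; apply: holds_or.
- exact: holds_eq.
- exact: holds_adj.
- by apply: holds_and; [apply: holds_course | apply: holds_course_ok].
- by apply: holds_and; [apply: holds_ta | apply: holds_ta_ok].
Qed.

Lemma holds_trial_ok H V : input_ok H -> V 0 = L ->
  holds L H V trial_okE (trial_ok (H Trial)).
Proof.
move=> H_ok V0; apply: holds_all => a _; apply: holds_imp; first by ev.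
apply: holds_and; first exact: holds_allowed.
apply: holds_all => b _; apply: holds_imp; first exact: holds_adj.
by apply: holds_and; [ev | apply: holds_not; apply: holds_eq; apply: holds_eq; ev].
Qed.

Lemma holds_kept_all H V : input_ok H -> V 0 = L ->
  holds L H V kept_allE (kept_all (H Kept)).
Proof.
move=> H_ok V0; by apply: holds_all => a _; apply: holds_imp; ev.
Qed.


(** * Orientations and partial solutions *)

Definition node a := 0 < a <= n + m.

Lemma adj_sym a b : adj a b = adj b a. Proof. exact: orbC. Qed.

Lemma adj_node a b : adj a b -> node a.
Proof.
rewrite /node; case/orP => /and3P[]; rewrite /is_course /is_ta; lia.
Qed.

Lemma allowed_node a v : node a -> allowed a v -> node v.
Proof.
move=> a_n /andP[/orP[/eqP->//|]]; rewrite adj_sym => /adj_node //.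
Qed.

(* [D a] is the neighbour [a] points to: the TA that course [a] leaves out, or the
   course assigned to TA [a]; [D a = a] if there is none. *)
Definition oriented (D : nat -> nat) :=
  forall a, node a -> allowed a (D a) /\
    forall b, adj a b -> (D a == b) != (D b == a).

Hypothesis nm_le : n + m <= L.

Lemma node_leq a : node a -> 0 < a <= L.
Proof. by rewrite /node; lia. Qed.

Lemma trial_okP T : reflect
  (forall a, 0 < a <= L -> T a != 0 -> allowed a (T a) /\
     forall b, adj a b -> T b != 0 /\ (T a == b) != (T b == a))
  (trial_ok T).
Proof.
have mem_L i : (i \in iota 1 L) = (0 < i <= L) by rewrite mem_iota add1n ltnS.
apply: (iffP allP) => [okT a a_L Ta0|okT a].
  have := okT a; rewrite mem_L a_L lt0n Ta0 => /(_ isT) /= /andP[aT /allP adjT].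
  split=> // b ab; have := adjT b; rewrite mem_L node_leq; last first.
    by rewrite adj_sym in ab; apply: adj_node ab.
  rewrite ab lt0n => /(_ isT) /= /andP[-> ].
  by case: (T a == b); case: (T b == a).
rewrite mem_L => /okT{okT} okT; apply/implyP; rewrite lt0n => /okT[-> adjT].
apply/allP => b _; apply/implyP => /adjT[]; rewrite lt0n => -> /=.
by case: (T a == b); case: (T b == a).
Qed.

Lemma run_propagate_step H V : input_ok H -> V 0 = L ->
  run L V propagate_step H =
    if [&& adj (V vA) (V vB), H Trial (V vA) != 0 & H Trial (V vA) != V vB]
    then set_cell H Trial (V vB) (V vA) else H.
Proof.
move=> H_ok V0; rewrite /propagate_step; set c := EAnd _ _.
have hc : holds L H V c
    [&& adj (V vA) (V vB), H Trial (V vA) != 0 & H Trial (V vA) != V vB].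
  by apply: holds_and; [apply: holds_adj | ev].
transitivity (if eval L H V c == 0 then H else set_cell H Trial (V vB) (V vA)).
  by [].
by rewrite hc; case: [&& _, _ & _].
Qed.

(** * Propagation along a fixed solution *)

Section Complete.

Variables (D : nat -> nat) (t p : nat).
Hypotheses (D_ok : oriented D) (t_node : node t).
Hypotheses (p_gt0 : 0 < p) (t_periodic : iter p D t = t).

Let D_node a : node a -> node (D a).
Proof. by move=> a_n; apply: (allowed_node a_n (D_ok a_n).1). Qed.

Let reaches a := exists k, iter k D a = t.

(** This is where the periodicity of [t] enters: [t] itself can take a step and still return to
    [t]. *)
Let reachesD a : reaches a -> reaches (D a).
Proof.
case=> -[|k] /= def_t; last by exists k; rewrite -iterSr.
by exists p.-1; rewrite def_t -iterSr prednK.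
Qed.

(** Exactly one of the two arrows runs along the edge. Either [b] is the successor of [a], or [a] is
    the successor of [b]; in both cases [b] reaches [t]. *)
Let reaches_adj a b : node a -> reaches a -> adj a b -> reaches b.
Proof.
move=> a_n ra ab; have := (D_ok a_n).2 _ ab; case: (D a =P b) => [<- _|_].
  exact: reachesD.
by case: (D b =P a) => // Db _; case: ra => k def_t; exists k.+1; rewrite iterSr Db.
Qed.

Let partial (H : store) := forall a, 0 < a <= L -> H Trial a != 0 ->
  [/\ node a, H Trial a = D a & reaches a].

Let inv (H : store) := [/\ input_ok H, partial H & H Trial t != 0].

(** A value is written to [b] only if [D a != b], and then the edge must carry the arrow [D b = a].
    So the step writes what [D] prescribes, whether or not [b] was decided before. *)
Let propagate_stepP a b H V : V 0 = L -> V vA = a -> V vB = b -> 0 < a <= L ->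
    inv H -> let H1 := run L V propagate_step H in
  [/\ inv H1, forall x, H Trial x != 0 -> H1 Trial x != 0
    & adj a b -> H Trial a != 0 -> D a != b -> H1 Trial b != 0].
Proof.
move=> V0 Va Vb a_L [H_ok H_part H_t].
rewrite run_propagate_step // Va Vb; case: ifP => [/and3P[ab Ta0 Tab]|cond /=]; last first.
  split=> // ab Ta0 Dab; have [_ Ta _] := H_part a a_L Ta0.
  by rewrite ab Ta0 Ta Dab in cond.
have a0 : a != 0 by rewrite -lt0n; case/andP: a_L.
have mono x : H Trial x != 0 -> set_cell H Trial b a Trial x != 0.
  by rewrite /set_cell; case: ifP.
split=> //; last by rewrite /set_cell !eqxx.
split=> //; last exact: mono.
move=> x x_L; rewrite /set_cell eqxx /=; case: (x =P b) => [-> _|_]; last exact: H_part.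
have [a_n Ta ra] := H_part a a_L Ta0.
have := (D_ok a_n).2 _ ab; rewrite -Ta (negPf Tab); case: (D b =P a) => // Db _.
split=> //; first by rewrite adj_sym in ab; apply: adj_node ab.
exact: reaches_adj ab.
Qed.

Let round V := run L V (For vA (For vB propagate_step)).

(** The premise looks at the state before the round. Decided nodes stay decided, so the order in
    which pairs are visited does not matter. *)
Let roundP H V : V 0 = L -> inv H ->
  [/\ inv (round V H), forall x, H Trial x != 0 -> round V H Trial x != 0
    & forall a b, node a -> node b ->
      adj a b -> H Trial a != 0 -> D a != b -> round V H Trial b != 0].
Proof.
move=> V0 H_inv; pose P H1 := inv H1 /\ forall x, H Trial x != 0 -> H1 Trial x != 0.
pose Q a b (H1 : store) :=
  adj a b -> H Trial a != 0 -> D a != b -> H1 Trial b != 0.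
have [[P1 P2] Q1] : P (round V H) /\
    forall a, 0 < a <= L -> forall b, 0 < b <= L -> Q a b (round V H).
  apply: (@downfrom_each _ P (fun a H1 => forall b, 0 < b <= L -> Q a b H1))
    => [//|a H1 a_L PH1|a a' H1 a_L a'_L [H1_inv H1_mono] Qa].
    apply: (@downfrom_each _ P (Q a))
      => [//|b H2 b_L [H2_inv H2_mono]|b b' H2 b_L b'_L [H2_inv _] Qb].
      have [] := @propagate_stepP a b H2 (upd (upd V vA a) vB b) V0 erefl erefl a_L H2_inv.
      move=> inv3 mono3 Q3; split; first by split=> // x /H2_mono/mono3.
      by move=> ab /H2_mono Ta; apply: Q3.
    have [] := @propagate_stepP a b' H2 (upd (upd V vA a) vB b') V0 erefl erefl a_L H2_inv.
    by move=> _ mono3 _ ab Ta Dab; apply/mono3/Qb.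
  move=> b b_L; pose H3 := run L (upd V vA a') (For vB propagate_step) H1.
  suff [] : inv H3 /\ Q a b H3 by [].
  apply: (@downfrom_inv _ (fun H2 => inv H2 /\ Q a b H2)) => [|b' H2 b'_L [H2_inv Qb]].
    by split=> //; apply: Qa.
  have [] := @propagate_stepP a' b' H2 (upd (upd V vA a') vB b') V0 erefl erefl a'_L H2_inv.
  by move=> inv3 mono3 _; split=> // ab Ta Dab; apply/mono3/Qb.
by split=> // a b /node_leq a_L /node_leq b_L; apply: Q1.
Qed.

(** Each round extends by one the distance, measured along arrows towards [t], up to which all nodes
    are decided. *)
Let propagateP V H r k : V 0 = L -> inv H ->
    (forall a j, node a -> j <= r -> iter j D a = t -> H Trial a != 0) ->
  let H1 := downfrom (fun i => round (upd V vR i)) k H in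
  inv H1 /\ forall a j, node a -> j <= r + k -> iter j D a = t -> H1 Trial a != 0.
Proof.
move=> V0; elim: k r H => [|k IH] r H H_inv Hr; first by rewrite addn0.
have [H1_inv mono prog] := @roundP H (upd V vR k.+1) V0 H_inv.
rewrite -addSnnS; apply: IH => // a j a_n; rewrite leq_eqVlt => /predU1P[->|lt_j def_t].
  rewrite iterSr => def_t; have Da_n := D_node a_n.
  have TDa := Hr _ _ Da_n (leqnn r) def_t.
  (* If [a] carries a loop, it is its own decided successor. Otherwise [D a] cannot point back along
     the edge to [a], hence it forces [a]. *)
  have [/andP[/orP[/eqP<-|a_Da] _] adjD] := D_ok a_n; first exact: mono.
  apply: (prog (D a) a) => //; first by rewrite adj_sym.
  by have := adjD _ a_Da; rewrite eqxx; case: (_ == a).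
exact/mono/(Hr a j).
Qed.

Definition run_trial V H :=
  run L V (Seq (Seq clear_trial (Store Trial (Var vS) (Var vV))) propagate) H.

(** The decided nodes are finally those that reach [t]: the invariant gives one inclusion, the
    number of rounds the other. Since this set is closed under adjacency and carries the arrows of
    [D], the check succeeds. *)
Lemma run_trialP V H : V 0 = L -> V vS = t -> V vV = D t -> input_ok H ->
  let T := run_trial V H Trial in
    trial_ok T /\ forall a k, node a -> iter k D a = t -> T a != 0.
Proof.
move=> V0 Vt VD H_ok; rewrite /run_trial.
set H1 := run L V (Seq clear_trial (Store Trial (Var vS) (Var vV))) H.
have H1_ok : input_ok H1 by rewrite /input_ok /H1 run_frame.
have [_ clear0] : True /\ forall a, 0 < a <= L -> run L V clear_trial H Trial a = 0.
  pose Q a (H2 : store) := H2 Trial a = 0.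
  apply: (@downfrom_all _ (fun=> True) Q) => // [i u _ _|i j u _ _ _];
    rewrite /Q /= /set_cell.
    by rewrite (_ : upd V vA i vA = i) // !eqxx.
  by case: ifP.
have Dt_n := D_node t_node.
have H1E a : 0 < a <= L -> H1 Trial a = if a == t then D t else 0.
  have -> : H1 = set_cell (run L V clear_trial H) Trial (V vS) (V vV) by [].
  by move=> a_L; rewrite /set_cell Vt VD; case: (a =P t) => // _; apply: clear0.
have H1_inv : inv H1.
  split=> //; last by rewrite H1E ?node_leq // eqxx -lt0n; case/andP: Dt_n.
  move=> a a_L; rewrite H1E //; case: (a =P t) => // -> _.
  by split=> //; exists 0.
have [|H2_inv reached] := @propagateP V H1 0 L V0 H1_inv.
  move=> a j a_n; rewrite leqn0 => /eqP-> /= ->.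
  by case: H1_inv.
rewrite -[downfrom _ _ _]/(run L V propagate H1) in H2_inv reached.
have {}reached a k : node a -> iter k D a = t -> run L V propagate H1 Trial a != 0.
  move=> a_n def_t; have [j le_j def_j] := short_path D_node a_n def_t.
  by apply: (reached a j) => //; rewrite add0n (leq_trans le_j).
change (trial_ok (run L V propagate H1 Trial) /\ forall a k,
  node a -> iter k D a = t -> run L V propagate H1 Trial a != 0).
split=> //; apply/trial_okP => a a_L Ta0; have [_ part _] := H2_inv.
have [a_n -> ra] := part a a_L Ta0; have [aD adjD] := D_ok a_n.
split=> // b ab; have b_n : node b by rewrite adj_sym in ab; apply: adj_node ab.
have [k def_k] := reaches_adj a_n ra ab; have Tb := reached b k b_n def_k.
by have [_ TbD _] := part b (node_leq b_n) Tb; split=> //; rewrite TbD; apply: adjD.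
Qed.

End Complete.

(** * Search over all seeds *)

Lemma input_ok_frame c V H :
  ~~ stores_to Input c -> input_ok H -> input_ok (run L V c H).
Proof. by move=> ? ?; rewrite /input_ok run_frame. Qed.

Lemma run_keep_trial V H a : 0 < a <= L ->
  run L V keep_trial H Kept a = if H Trial a != 0 then H Trial a else H Kept a.
Proof.
move=> a_L; pose P (H1 : store) := H1 Trial = H Trial /\ forall a,
  H1 Kept a = H Kept a \/ H Trial a != 0 /\ H1 Kept a = H Trial a.
pose Q a (H1 : store) := H Trial a != 0 -> H1 Kept a = H Trial a.
pose c := If (ELt (Lit 0) (Get Trial (Var vA))) (Store Kept (Var vA) (Get Trial (Var vA))).
have stepE W H1 : run L W c H1 =
    if H1 Trial (W vA) != 0 then set_cell H1 Kept (W vA) (H1 Trial (W vA)) else H1.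
  have hc : holds L H1 W (ELt (Lit 0) (Get Trial (Var vA))) (0 < H1 Trial (W vA)).
    by ev.
  transitivity (if eval L H1 W (ELt (Lit 0) (Get Trial (Var vA))) == 0 then H1
                else set_cell H1 Kept (W vA) (H1 Trial (W vA))); first by [].
  by rewrite hc lt0n; case: (H1 Trial (W vA) == 0).
have [[_ PK] QK] : P (run L V keep_trial H) /\
    forall a, 0 < a <= L -> Q a (run L V keep_trial H).
  apply: (@downfrom_each _ P Q) => [|i H1 i_L [H1T H1K]|i j H1 i_L j_L [H1T _]].
  - by split=> // i; left.
  - change (P (run L (upd V vA i) c H1) /\ Q i (run L (upd V vA i) c H1)).
    rewrite stepE (_ : upd V vA i vA = i) // H1T; split; last first.
      by rewrite /Q => Ti; rewrite Ti /set_cell /= eqxx.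
    split=> [|x]; first by case: ifP.
    case: ifP => [Ti|_]; last exact: H1K.
    by rewrite /set_cell /=; case: (x =P i) => [->|_]; [right | apply: H1K].
  - change (Q i H1 -> Q i (run L (upd V vA j) c H1)).
    rewrite /Q stepE (_ : upd V vA j vA = j) // H1T => QK Ti.
    case: ifP => [Tj|_]; last exact: QK.
    by rewrite /set_cell /=; case: (i =P j) => [->|_] //; apply: QK.
case: ifP => [Ta|/negbT Ta]; first exact: QK.
by have [//|[Ta']] := PK a; rewrite Ta' in Ta.
Qed.

Lemma run_try_seed V H : run L V try_seed H =
  let H1 := run_trial V H in
  if eval L H1 V trial_okE == 0 then H1 else run L V keep_trial H1.
Proof. by []. Qed.

(** The decided nodes of each partial solution are closed under adjacency, so no edge joins a node
    taken from [T] to a node taken from [K]. *)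
Lemma trial_ok_merge T K K1 : trial_ok T -> trial_ok K ->
    (forall a, 0 < a <= L -> K1 a = if T a != 0 then T a else K a) -> trial_ok K1.
Proof.
move=> /trial_okP T_ok /trial_okP K_ok K1E; apply/trial_okP => a a_L.
have adj_L b : adj a b -> 0 < b <= L.
  by rewrite adj_sym => /adj_node/node_leq.
rewrite K1E //; case: ifP => [Ta _|/negbT Ta0 Ka].
  have [aT adjT] := T_ok a a_L Ta; split=> // b ab.
  by have [Tb xorT] := adjT b ab; rewrite K1E ?adj_L // Tb.
have [aK adjK] := K_ok a a_L Ka; split=> // b ab; rewrite K1E ?adj_L //.
case: ifP => [Tb|_]; last exact: adjK.
have [_ adjT] := T_ok b (adj_L b ab) Tb.
by have [Ta _] := adjT a (etrans (adj_sym b a) ab); rewrite Ta in Ta0.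
Qed.

(** What the seed [(t, v)] guarantees, relative to any solution for which it is right; a wrong seed
    guarantees nothing. *)
Definition seeded t v (K : nat -> nat) := forall D p, oriented D -> node t ->
  0 < p -> iter p D t = t -> v = D t -> forall a k, node a -> iter k D a = t -> K a != 0.

Lemma try_seedP V H : V 0 = L -> input_ok H -> trial_ok (H Kept) ->
  let H1 := run L V try_seed H in
  [/\ input_ok H1, trial_ok (H1 Kept),
      forall a, 0 < a <= L -> H Kept a != 0 -> H1 Kept a != 0
    & seeded (V vS) (V vV) (H1 Kept)].
Proof.
move=> V0 H_ok K_ok; rewrite run_try_seed; set H2 := run_trial V H.
have H2_ok : input_ok H2 by apply: input_ok_frame.
have H2K : H2 Kept = H Kept by apply: run_frame.
have hc : holds L H2 V trial_okE (trial_ok (H2 Trial)) by apply: holds_trial_ok.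
cbv zeta; rewrite hc eqb0 if_neg; case: ifP => [T_ok|T_ko].
  have KE a a_L := @run_keep_trial V H2 a a_L; rewrite H2K in KE.
  split.
  - exact: input_ok_frame.
  - exact: trial_ok_merge KE.
  - by move=> a a_L Ka; rewrite KE //; case: ifP.
  - move=> D p D_ok s_n p0 per Vv a k a_n def_k.
    rewrite KE ?node_leq //; case: ifP => // /negbT/negP[].
    have [_ reached] := run_trialP D_ok s_n p0 per V0 erefl Vv H_ok.
    exact: reached def_k.
(* A right seed passes the check, so a rejected one satisfies [seeded] vacuously. *)
split=> //; rewrite ?H2K // => D p D_ok s_n p0 per Vv.
by have [] := run_trialP D_ok s_n p0 per V0 erefl Vv H_ok; rewrite -/H2 T_ko.
Qed.

Definition init_kept := For vA (Store Kept (Var vA) (Lit 0)).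

Lemma run_init_kept V H a : 0 < a <= L -> run L V init_kept H Kept a = 0.
Proof.
move=> a_L; pose Q a (H1 : store) := H1 Kept a = 0.
have [_ QK] : True /\ forall a, 0 < a <= L -> Q a (run L V init_kept H).
  apply: (@downfrom_all _ (fun=> True) Q) => // [i u _ _|i j u _ _ _];
    rewrite /Q /= /set_cell.
    by rewrite (_ : upd V vA i vA = i) // !eqxx.
  by case: ifP.
exact: QK.
Qed.

Lemma searchP V H : V 0 = L -> input_ok H -> trial_ok (H Kept) ->
  let H1 := run L V search H in
  [/\ input_ok H1, trial_ok (H1 Kept)
    & forall D, oriented D -> forall a, node a -> H1 Kept a != 0].
Proof.
move=> V0 H_ok K_ok.
pose P H1 := input_ok H1 /\ trial_ok (H1 Kept).
pose Q t v (H1 : store) := seeded t v (H1 Kept).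
have seeded_mono t v (K K1 : nat -> nat) :
    (forall a, 0 < a <= L -> K a != 0 -> K1 a != 0) -> seeded t v K -> seeded t v K1.
  move=> KK seedK D p D_ok t_n p0 per Vv a k a_n def_k.
  by apply: KK; [apply: node_leq | apply: (seedK D p _ _ _ _ _ a k)].
have [[H1_ok K1_ok] Q1] : P (run L V search H) /\
    forall t, 0 < t <= L -> forall v, 0 < v <= L -> Q t v (run L V search H).
  apply: (@downfrom_each _ P (fun t H1 => forall v, 0 < v <= L -> Q t v H1)).
  - by [].
  - move=> t H1 t_L PH1; apply: (@downfrom_each _ P (Q t))
      => // [v H2 v_L|v v' H2 _ _] [H2_ok K2_ok].
      by have [? ? _ ?] := @try_seedP (upd (upd V vS t) vV v) H2 V0 H2_ok K2_ok.
    have [_ _ mono _] := @try_seedP (upd (upd V vS t) vV v') H2 V0 H2_ok K2_ok.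
    exact: seeded_mono mono.
  - move=> t t' H1 t_L t'_L PH1 Qs v v_L.
    pose H3 := run L (upd V vS t') (For vV try_seed) H1.
    suff [] : P H3 /\ Q t v H3 by [].
    apply: (@downfrom_inv _ (fun H2 => P H2 /\ Q t v H2))
      => [|v' H2 v'_L [[H2_ok K2_ok] Qt2]].
      by split=> //; apply: Qs.
    have [? ? mono _] := @try_seedP (upd (upd V vS t') vV v') H2 V0 H2_ok K2_ok.
    by split=> //; apply: seeded_mono mono Qt2.
split=> // D D_ok a a_n; have D_node b : node b -> node (D b).
  by move=> b_n; apply: (allowed_node b_n (D_ok b b_n).1).
(* The seed that accounts for [a] sits at a periodic point on the orbit of [a]. *)
have [i [p [p0 per]]] := periodic_point D_node a_n.
have t_n := iter_node D_node i a_n.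
apply: (Q1 (iter i D a) _ (D (iter i D a)) _ D p) => //; try exact: node_leq.
exact/node_leq/D_node.
Qed.

(** * Writing the answer *)

Hypothesis m_lt : m < L.

(** The node of a course is also its code in the answer. A node above [n] is the loop of an
    unassigned TA, whose code is 0. *)
Definition answer_item (K : nat -> nat) a := if K a <= n then K a else 0.

Lemma run_write_item V H a : V 0 = L -> V vA = a -> input_ok H ->
  run L V write_item H Output =
    (if is_ta a then
       fun j => if j == pos m.+1 (a - n).+1 then answer_item (H Kept) a
                else H Output j
     else H Output).
Proof.
move=> V0 Va H_ok; have Va' : evals L H V (Var vA) a by [].
have hta : holds L H V (is_taE (Var vA)) (is_ta a) by apply: holds_ta.
pose p := out_posE (Bin Add (Bin Defs.Sub (Var vA) nE) (Lit 1)).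
have hp H1 : input_ok H1 -> evals L H1 V p (pos m.+1 (a - n).+1).
  by move=> H1_ok; rewrite -(addn1 m) -(addn1 (a - n)) /p /out_posE; ev.
pose H1 := set_cell H Output (eval L H V p) 0.
have H1_ok : input_ok H1 by [].
have hk : holds L H1 V (ELe (Get Kept (Var vA)) nE) (H Kept a <= n).
  by apply: holds_le; [rewrite -Va; apply: evals_get | apply: evals_n].
transitivity ((if eval L H V (is_taE (Var vA)) == 0 then H else
  if eval L H1 V (ELe (Get Kept (Var vA)) nE) == 0 then H1 else
  set_cell H1 Output (eval L H1 V p) (H Kept (V vA))) Output); first by [].
rewrite hta hk (hp _ H1_ok) /H1 (hp _ H_ok) Va !eqb0 !if_neg /answer_item.
case: (is_ta a) => //; apply: functional_extensionality => j.
by case: ifP => _; rewrite /set_cell /=; case: eqP.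
Qed.

Lemma pos_inj k i j : 0 < i <= k -> 0 < j <= k -> pos k i = pos k j -> i = j.
Proof. by rewrite /pos; case: (leqP i nreg); case: (leqP j nreg); lia. Qed.

Lemma run_write_answer V H : V 0 = L -> input_ok H ->
  let O := run L V write_answer H Output in
  [/\ O 0 = m.+1, O (pos m.+1 1) = 1
    & forall t, t < m -> O (pos m.+1 t.+2) = answer_item (H Kept) (n + t.+1)].
Proof.
move=> V0 H_ok.
pose c1 := For vA (If (EEq (Var vA) (Bin Add mE (Lit 1))) (Store Output (Lit 0) (Var vA))).
pose H1 := run L V c1 H; have H1_ok : input_ok H1 by apply: input_ok_frame.
have H1K : H1 Kept = H Kept by apply: run_frame.
have H10 : H1 Output 0 = m.+1.
  pose Q i (H2 : store) := i = m.+1 -> H2 Output 0 = m.+1.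
  pose c := If (EEq (Var vA) (Bin Add mE (Lit 1))) (Store Output (Lit 0) (Var vA)).
  have stepE i H2 : input_ok H2 -> run L (upd V vA i) c H2 =
      if i == m.+1 then set_cell H2 Output 0 i else H2.
    move=> H2_ok; have hc : holds L H2 (upd V vA i)
        (EEq (Var vA) (Bin Add mE (Lit 1))) (i == m.+1) by rewrite -(addn1 m); ev.
    transitivity (if eval L H2 (upd V vA i) (EEq (Var vA) (Bin Add mE (Lit 1))) == 0
      then H2 else set_cell H2 Output 0 i); first by [].
    by rewrite hc eqb0 if_neg.
  have [_ Q1] : input_ok H1 /\ forall i, 0 < i <= L -> Q i H1.
    apply: (@downfrom_each _ input_ok Q) => // [i H2 _ H2_ok|i j H2 _ _ H2_ok].
      change (input_ok (run L (upd V vA i) c H2) /\ Q i (run L (upd V vA i) c H2)).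
      by rewrite stepE // /Q; split; [case: ifP | move=> ->; rewrite eqxx].
    change (Q i H2 -> Q i (run L (upd V vA j) c H2)).
    by rewrite stepE // /Q => Qi /Qi E; case: ifP => // /eqP->.
  exact: (Q1 m.+1 m_lt erefl).
pose H2 := run L V (Store Output (out_posE (Lit 1)) (Lit 1)) H1.
have H2_ok : input_ok H2 by apply: input_ok_frame.
have H2O j : H2 Output j = if j == pos m.+1 1 then 1 else H1 Output j.
  have hp : evals L H1 V (out_posE (Lit 1)) (pos m.+1 1).
    by rewrite -(addn1 m) /out_posE; ev.
  by rewrite -hp.
have pos_neq0 i : 0 < i -> pos m.+1 i != 0 by rewrite /pos; case: ifP; lia.
pose P H3 := [/\ input_ok H3, H3 Kept = H Kept, H3 Output 0 = m.+1
  & H3 Output (pos m.+1 1) = 1].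
pose Q i (H3 : store) := is_ta i ->
  H3 Output (pos m.+1 (i - n).+1) = answer_item (H Kept) i.
have [[_ _ P0 P1] Q3] : P (run L V (For vA write_item) H2) /\
    forall i, 0 < i <= L -> Q i (run L V (For vA write_item) H2).
  apply: (@downfrom_each _ P Q).
  - split=> //; last by rewrite H2O eqxx.
    by rewrite H2O eq_sym (negPf (pos_neq0 _ _)).
  - move=> i H3 i_L [H3_ok H3K H30 H31].
    change (P (run L (upd V vA i) write_item H3) /\ Q i (run L (upd V vA i) write_item H3)).
    have E := @run_write_item (upd V vA i) H3 i V0 erefl H3_ok.
    split; last by rewrite /Q E => ->; rewrite eqxx H3K.
    split; [exact: input_ok_frame | by rewrite run_frame | |];
      rewrite E; case: ifP => // ti.
      by rewrite eq_sym (negPf (pos_neq0 _ _)).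
    case: eqP => // /pos_inj; rewrite /is_ta in ti.
    by move=> /(_ isT) abs; have := abs; lia.
  - move=> i j H3 i_L j_L [H3_ok H3K H30 H31].
    change (Q i H3 -> Q i (run L (upd V vA j) write_item H3)).
    have E := @run_write_item (upd V vA j) H3 j V0 erefl H3_ok.
    rewrite /Q E => Qi ti; case: ifP => [tj|_]; last exact: Qi.
    case: eqP => [/pos_inj eq_ij|_]; last exact: Qi.
    rewrite (_ : i = j) ?H3K //; have := eq_ij; rewrite /is_ta in ti tj; lia.
split=> // t lt_t.
have := Q3 (n + t.+1) (@node_leq (n + t.+1) _); rewrite /Q addKn; apply.
  by rewrite /node; lia.
by rewrite /is_ta; lia.
Qed.

(** If all nodes are decided, the kept arrows are themselves a solution. If some node is not, no
    solution exists, as any solution would have had all nodes decided by the search. *)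
Lemma solverP H : input_ok H -> let O := run L (fun=> L) mefe_solver H Output in
  (exists D, [/\ oriented D, O 0 = m.+1, O (pos m.+1 1) = 1
    & forall t, t < m -> O (pos m.+1 t.+2) = answer_item D (n + t.+1)]) \/
  [/\ ~ exists D, oriented D, O 0 = 1 & O (pos 1 1) = 0].
Proof.
move=> H_ok; pose V := fun _ : nat => L.
pose H1 := run L V init_kept H; have H1_ok : input_ok H1 by apply: input_ok_frame.
have K1_ok : trial_ok (H1 Kept).
  by apply/trial_okP => a a_L; rewrite /H1 run_init_kept ?eqxx.
pose H2 := run L V search H1.
have [H2_ok /trial_okP K2_ok comp] := @searchP V H1 erefl H1_ok K1_ok.
rewrite -/H2 in H2_ok K2_ok comp.
pose H3 := set_cell (set_cell H2 Output 0 1) Output (pos 1 1) 0.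
have hk : holds L H3 V kept_allE (kept_all (H2 Kept)) by apply: (@holds_kept_all H3).
have -> : run L V mefe_solver H = if eval L H3 V kept_allE == 0 then H3
                                  else run L V write_answer H3 by [].
rewrite hk eqb0 if_neg; case: ifP => [/allP all_kept|not_all] O; [left | right].
  have K_n a : node a -> H2 Kept a != 0.
    move=> a_n; have := all_kept a; rewrite mem_iota add1n ltnS node_leq // => /(_ isT).
    by case/andP: a_n => _ ->; rewrite lt0n.
  exists (H2 Kept); rewrite /O; have [? ? ?] := @run_write_answer V H3 erefl H2_ok.
  split=> // a a_n; have [aK adjK] := K2_ok a (node_leq a_n) (K_n a a_n).
  by split=> // b /adjK[].
split=> // -[D /comp K_n]; move/negP: not_all; case; apply/allP => a.
rewrite mem_iota add1n ltnS => /andP[a0 _]; apply/implyP => a_nm.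
by rewrite lt0n K_n // /node a0.
Qed.

End Semantics.

(** * Matchings and orientations *)

Lemma nth_flatten_uniform (T : Type) (x0 : T) (ss : seq (seq T)) k i j :
    (forall r, r \in [seq size r | r <- ss] -> r = k) -> i < size ss -> j < k ->
  nth x0 (flatten ss) (i * k + j) = nth x0 (nth [::] ss i) j.
Proof.
elim: ss i => //= r ss IH i sz lt_i lt_j.
have szr : size r = k by apply: sz; rewrite mem_head.
rewrite nth_cat szr; case: i lt_i => [|i] lt_i; first by rewrite add0n lt_j.
rewrite mulSn -addnA ltnNge leq_addr /= addKn; apply: IH => // q q_in.
by apply: sz; rewrite inE q_in orbT.
Qed.

Lemma size_flatten_uniform (T : Type) (ss : seq (seq T)) k :
    (forall r, r \in [seq size r | r <- ss] -> r = k) ->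
  size (flatten ss) = size ss * k.
Proof.
elim: ss => //= r ss IH sz; rewrite size_cat (sz (size r)) ?mem_head //.
by rewrite IH // => q q_in; apply: sz; rewrite inE q_in orbT.
Qed.

Lemma nth_enum_map (T : Type) (x0 : T) k (F : 'I_k -> T) (i : 'I_k) :
  nth x0 [seq F j | j <- enum 'I_k] i = F i.
Proof. by rewrite (nth_map i) ?size_enum_ord // nth_ord_enum. Qed.

(** Cross-multiplication. The encoding keeps absolute values only, which loses nothing on
    nonnegative rationals. *)
Lemma ler_rat_nat (p q : rat) : (0 <= p)%R -> (0 <= q)%R ->
  (p <= q)%R = (`|numq p| * `|denq q| <= `|numq q| * `|denq p|).
Proof.
move=> p0 q0.
have ap : (numq p = `|numq p|%N :> int)%R by rewrite gez0_abs // numq_ge0.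
have aq : (numq q = `|numq q|%N :> int)%R by rewrite gez0_abs // numq_ge0.
have bp : (denq p = `|denq p|%N :> int)%R by rewrite gez0_abs // denq_ge0.
have bq : (denq q = `|denq q|%N :> int)%R by rewrite gez0_abs // denq_ge0.
rewrite -lez_nat !PoszM -ap -aq -bp -bq.
rewrite -{1}[p]divq_num_den -{1}[q]divq_num_den.
rewrite ler_pdivrMr ?ltr0z ?denq_gt0 // mulrAC ler_pdivlMr ?ltr0z ?denq_gt0 //.
by rewrite -!intrM ler_int.
Qed.

(** * Layout of the encoded instance *)

Section Encoding.

Variable I : instance.
Local Notation n := (nb_courses I).
Local Notation m := (nb_tas I).
Let s := encode I.

Let tas := flatten [seq encode_ta t | t <- enum 'I_m].

Lemma size_grades (t : ta I) :
  size (flatten [seq encode_rat (grade t x) | x <- enum 'I_n]) = n * 2.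
Proof.
rewrite (size_flatten_uniform (k := 2)); first by rewrite size_map size_enum_ord.
by move=> r /mapP[q /mapP[x _ ->] ->].
Qed.

Lemma size_encode_ta t : size (@encode_ta I t) = 1 + 3 * n.
Proof. by rewrite /= size_cat size_map size_enum_ord size_grades; lia. Qed.

Lemma size_encode_course x : size (@encode_course I x) = 1 + m.
Proof. by rewrite /= size_map size_enum_ord. Qed.

Lemma size_tas : size tas = m * (1 + 3 * n).
Proof.
rewrite /tas (size_flatten_uniform (k := 1 + 3 * n)).
  by rewrite size_map size_enum_ord.
by move=> r /mapP[q /mapP[x _ ->] ->]; apply: size_encode_ta.
Qed.

Lemma size_encode : size s = 4 + m * (1 + 3 * n) + n * (1 + m).
Proof.
rewrite /s /encode /= size_cat size_tas (size_flatten_uniform (k := 1 + m)).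
  by rewrite size_map size_enum_ord; lia.
by move=> r /mapP[q /mapP[x _ ->] ->]; apply: size_encode_course.
Qed.

Lemma itemS i : item s i.+1 = nth 0 s i.
Proof. by rewrite /item /load /=; case: ltnP => // le_i; rewrite nth_default. Qed.

Lemma item1 : item s 1 = n. Proof. exact: itemS. Qed.
Lemma item2 : item s 2 = m. Proof. exact: itemS. Qed.
Lemma item3 : item s 3 = `|numq (threshold I)|. Proof. exact: itemS. Qed.
Lemma item4 : item s 4 = `|denq (threshold I)|. Proof. exact: itemS. Qed.

Definition course_node (x : 'I_n) := x.+1.
Definition ta_node (t : 'I_m) := n + t.+1.

Lemma item_row t i : i < 1 + 3 * n ->
  item s (ta_row s (ta_node t) + i) = nth 0 (encode_ta t) i.
Proof.
move=> lt_i; rewrite /ta_row item1 /ta_node.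
have -> : 5 + (n + t.+1 - (n + 1)) * (1 + 3 * n) + i = (4 + (t * (1 + 3 * n) + i)).+1.
  by rewrite -(addn1 t) subnDl addnK; lia.
have lt_t : t * (1 + 3 * n) + i < m * (1 + 3 * n) by have := ltn_ord t; nia.
rewrite itemS /s /encode /= nth_cat size_tas lt_t.
rewrite nth_flatten_uniform //; first by rewrite nth_enum_map.
  by move=> r /mapP[q /mapP[x _ ->] ->]; apply: size_encode_ta.
by rewrite size_map size_enum_ord.
Qed.

Lemma item_crow x i : i < 1 + m ->
  item s (course_row s (course_node x) + i) = nth 0 (encode_course x) i.
Proof.
move=> lt_i; rewrite /course_row item1 item2 /course_node subn1.
have -> : 5 + m * (1 + 3 * n) + x.+1.-1 * (1 + m) + i =
    (4 + (m * (1 + 3 * n) + (x * (1 + m) + i))).+1 by rewrite /=; lia.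
rewrite itemS /s /encode /= nth_cat size_tas ifF; last first.
  by apply/negbTE; rewrite -leqNgt leq_addr.
rewrite add0n addKn.
rewrite nth_flatten_uniform //; first by rewrite nth_enum_map.
  by move=> r /mapP[q /mapP[y _ ->] ->]; apply: size_encode_course.
by rewrite size_map size_enum_ord.
Qed.

Lemma util_node t x : util_of s (ta_node t) (course_node x) = util t x.
Proof.
rewrite /util_of item_row; last by rewrite /course_node; have := ltn_ord x; lia.
by rewrite /= nth_cat size_map size_enum_ord ltn_ord nth_enum_map.
Qed.

Lemma grade_node t (x : 'I_n) j : j < 2 ->
  item s (ta_row s (ta_node t) + n + 2 * x + 1 + j) = nth 0 (encode_rat (grade t x)) j.
Proof.
move=> lt_j.
have -> : ta_row s (ta_node t) + n + 2 * x + 1 + j =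
    ta_row s (ta_node t) + (n + (x * 2 + j)).+1 by lia.
rewrite item_row; last by have := ltn_ord x; lia.
rewrite /= nth_cat size_map size_enum_ord ltnNge leq_addr /= addKn.
rewrite nth_flatten_uniform //; first by rewrite nth_enum_map.
  by move=> r /mapP[q /mapP[y _ ->] ->].
by rewrite size_map size_enum_ord.
Qed.

Lemma num_node t x : num_of s (ta_node t) (course_node x) = `|numq (grade t x)|.
Proof.
rewrite /num_of item1 -[RHS]/(nth 0 (encode_rat (grade t x)) 0) -grade_node //.
by congr item; rewrite /course_node; lia.
Qed.

Lemma den_node t x : den_of s (ta_node t) (course_node x) = `|denq (grade t x)|.
Proof.
rewrite /den_of item1 -[RHS]/(nth 0 (encode_rat (grade t x)) 1) -grade_node //.
by congr item; rewrite /course_node; lia.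
Qed.

Lemma cap_node x : cap_of s (course_node x) = capacity x.
Proof. by rewrite /cap_of -[course_row _ _]addn0 item_crow. Qed.

Lemma val_node x t : val_of s (course_node x) (ta_node t) = value x t.
Proof.
rewrite /val_of item1 /ta_node addKn item_crow; last by have := ltn_ord t; lia.
by rewrite /= nth_enum_map.
Qed.

(** Each TA and each course contributes an item of its own, the length prefix or the capacity, even
    if the other side is empty. *)
Lemma size_nm : n + m <= size s.
Proof. by rewrite size_encode; nia. Qed.

Lemma size_m : m < size s.
Proof. by rewrite size_encode; nia. Qed.

Lemma is_course_node x : is_course s (course_node x).
Proof. by rewrite /is_course item1 /course_node ltn_ord. Qed.

Lemma is_ta_node t : is_ta s (ta_node t).
Proof. by rewrite /is_ta item1 item2 /ta_node; have := ltn_ord t; lia. Qed.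

Lemma is_courseP a : reflect (exists x, a = course_node x) (is_course s a).
Proof.
apply: (iffP idP) => [|[x ->]]; last exact: is_course_node.
by case: a => // a; rewrite /is_course item1 => /= lt_a; exists (Ordinal lt_a).
Qed.

Lemma is_taP a : reflect (exists t, a = ta_node t) (is_ta s a).
Proof.
apply: (iffP idP) => [|[t ->]]; last exact: is_ta_node.
rewrite /is_ta item1 item2 => /andP[lt_a le_a].
have lt_t : a - n.+1 < m by lia.
by exists (Ordinal lt_t); rewrite /ta_node /=; lia.
Qed.

Lemma nodeE a : node s a = is_course s a || is_ta s a.
Proof. by rewrite /node /is_course /is_ta item1 item2; lia. Qed.

Lemma node_course x : node s (course_node x).
Proof. by rewrite nodeE is_course_node. Qed.

Lemma node_ta t : node s (ta_node t).
Proof. by rewrite nodeE is_ta_node orbT. Qed.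

Lemma is_ta_courseF x : is_ta s (course_node x) = false.
Proof.
by apply/negbTE; rewrite /is_ta item1 /course_node negb_and -leqNgt ltn_ord.
Qed.

Lemma is_course_taF t : is_course s (ta_node t) = false.
Proof. by apply/negbTE; rewrite /is_course item1 /ta_node; lia. Qed.

Lemma course_node_inj : injective course_node.
Proof. by move=> x y [] /val_inj. Qed.

Lemma ta_node_inj : injective ta_node.
Proof. by move=> t u /addnI[] /val_inj. Qed.

Lemma course_ta_neq x t : (course_node x == ta_node t) = false.
Proof.
by apply/eqP => eq_xt; have := is_course_node x; rewrite eq_xt is_course_taF.
Qed.

Lemma edge_node x t : edge s (course_node x) (ta_node t) = (0 < util t x).
Proof. by rewrite /edge is_course_node is_ta_node util_node. Qed.

Lemma adj_course_ta x t : adj s (course_node x) (ta_node t) = (0 < util t x).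
Proof. by rewrite /adj edge_node /edge is_course_taF /= orbF. Qed.

Lemma adj_courseP x b :
  reflect (exists2 t, b = ta_node t & 0 < util t x) (adj s (course_node x) b).
Proof.
apply: (iffP idP) => [|[t ->]]; last by rewrite adj_course_ta.
case/orP => /and3P[]; last by rewrite is_ta_courseF.
by move=> _ /is_taP[t ->]; rewrite util_node => u_gt0; exists t.
Qed.

Lemma adj_taP t b :
  reflect (exists2 x, b = course_node x & 0 < util t x) (adj s (ta_node t) b).
Proof.
apply: (iffP idP) => [|[x ->]]; last by rewrite adj_sym adj_course_ta.
case/orP => /and3P[]; first by rewrite is_course_taF.
by move=> /is_courseP[x ->] _; rewrite util_node => u_gt0; exists x.
Qed.

Lemma sum_tas (F : nat -> nat) :
  \sum_(1 <= b < (size s).+1) is_ta s b * F b = \sum_(t < m) F (ta_node t).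
Proof.
have := size_nm; move: (size s) => L le_nm; pose G b := is_ta s b * F b.
have -> : \sum_(1 <= b < L.+1) G b =
    \sum_(1 <= b < n.+1) G b + (\sum_(n.+1 <= b < (n + m).+1) G b +
      \sum_((n + m).+1 <= b < L.+1) G b).
  by rewrite -!big_cat_nat ?ltnS // (leq_trans (leq_addr m n)).
rewrite [X in X + _]big_nat_cond [X in X + _]big1; last first.
  move=> b /andP[/andP[b0 le_b] _].
  by rewrite /G /is_ta item1 ltnNge -ltnS le_b.
rewrite [X in _ + (_ + X)]big_nat_cond [X in _ + (_ + X)]big1; last first.
  move=> b /andP[/andP[lt_b _] _].
  by rewrite /G /is_ta item1 item2 [b <= _]leqNgt lt_b andbF.
have -> : (n + m).+1 = m + n.+1 by rewrite addnS addnC.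
rewrite add0n addn0 -{1}[n.+1]add0n big_addn addnK big_mkord.
apply: eq_bigr => t _; rewrite /G (_ : t + n.+1 = ta_node t) ?is_ta_node ?mul1n //.
by rewrite /ta_node addnC addSnnS.
Qed.

(** * Node conditions in terms of a matching *)

Section Matching.

(** [D] and [mu] describe one assignment, seen from the TAs in [mu_assigned] and from the courses in
    [mu_excluded]. Both translations, from orientations and from matchings, supply these facts. *)
Variables (D : nat -> nat) (mu : matching I).
Hypothesis mu_assigned : forall t x, mu t = Some x <-> D (ta_node t) = course_node x.
Hypothesis mu_excluded : forall t x,
  mu t = Some x <-> 0 < util t x /\ D (course_node x) != ta_node t.

Let assigned t x : (mu t == Some x) = (D (course_node x) != ta_node t) && (0 < util t x).
Proof.
by apply/eqP/andP => [/mu_excluded[]|[? ?]] //; apply/mu_excluded.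
Qed.

Lemma course_ok_matching x : course_ok s (course_node x) (D (course_node x)) <->
  #|[set t : ta I | mu t == Some x]| = capacity x /\
  (threshold I <= avg_util mu x)%R.
Proof.
have card_mu : #|[set t : ta I | mu t == Some x]| =
    \sum_(1 <= b < (size s).+1)
      (others s (D (course_node x)) b && (0 < util_of s b (course_node x))).
  rewrite -sum1_card [RHS](eq_bigr (fun b => is_ta s b * ((b != D (course_node x)) &&
    (0 < util_of s b (course_node x))))); last first.
    by move=> b _; rewrite /others mulnb andbA.
  rewrite sum_tas [RHS](eq_bigr (fun t : 'I_m => (mu t == Some x) : nat)) => [|t _].
    by rewrite big_mkcond; apply: eq_bigr => t _; rewrite inE; case: (mu t == Some x).
  by rewrite util_node assigned eq_sym.
have sum_mu : \sum_(t | mu t == Some x) value x t =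
    \sum_(1 <= b < (size s).+1) others s (D (course_node x)) b * val_of s (course_node x) b.
  rewrite [RHS](eq_bigr (fun b => is_ta s b * ((b != D (course_node x)) *
    val_of s (course_node x) b))); last first.
    by move=> b _; rewrite /others -mulnb mulnA.
  rewrite sum_tas big_mkcond /=; apply: eq_bigr => t _.
  rewrite val_node assigned [ta_node t == _]eq_sym.
  case: eqP => _ /=; rewrite ?mul0n ?mul1n //.
  (* The sum over the other TAs includes those that do not value the course; they contribute zero by
     [value_eq0]. *)
  by case: posnP => // u0; apply/eqP; rewrite eq_sym value_eq0 u0.
have c0 : (0 < (capacity x)%:R :> rat)%R by rewrite ltr0n capacity_gt0.
have k0 : (0 < (denq (threshold I))%:~R :> rat)%R by rewrite ltr0z denq_gt0.
have avgE : (threshold I <= avg_util mu x)%R =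
    (`|numq (threshold I)| * capacity x <=
     `|denq (threshold I)| * \sum_(t | mu t == Some x) value x t).
  rewrite /avg_util -natr_sum mulrC ler_pdivlMr // -{1}[threshold I]divq_num_den.
  rewrite mulrAC ler_pdivrMr // [X in _ = (_ <= X)]mulnC -(ler_nat rat) !natrM.
  by rewrite !natr_absz !ger0_norm ?denq_ge0 // numq_ge0 threshold_ge0.
rewrite /course_ok item3 item4 cap_node -card_mu -sum_mu avgE.
by split=> [/andP[/eqP]|[-> ->]] //; rewrite eqxx.
Qed.

Hypothesis D_ta : forall t, D (ta_node t) = ta_node t \/
  exists x, D (ta_node t) = course_node x.

(** At a loop [util_of] reads an unrelated item; the factor replaces it by 0, the utility of being
    unassigned. *)
Lemma util_optE t :
  (D (ta_node t) != ta_node t) * util_of s (ta_node t) (D (ta_node t)) =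
    util_opt t (mu t).
Proof.
case: (D_ta t) => [Dt|[x Dt]].
  rewrite Dt eqxx mul0n; case def_mu: (mu t) => [x|] //.
  by move/mu_assigned/eqP: def_mu; rewrite Dt eq_sym course_ta_neq.
by rewrite Dt course_ta_neq mul1n util_node ((mu_assigned t x).2 Dt).
Qed.

Lemma mem_iota_size i : (i \in iota 1 (size s)) = (0 < i <= size s).
Proof. by rewrite mem_iota add1n ltnS. Qed.

Lemma course_node_leq x : 0 < course_node x <= size s.
Proof. by apply: (node_leq size_nm); apply: node_course. Qed.

Lemma ta_node_leq t : 0 < ta_node t <= size s.
Proof. by apply: (node_leq size_nm); apply: node_ta. Qed.

(** On the right [j] ranges over all TAs that value [x], not only those assigned to it. This makes
    the test independent of the arrows of other nodes; that a MEFE matching passes it rests on the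
    degree condition. *)
Lemma ta_ok_matching t : ta_ok s (ta_node t) (D (ta_node t)) <->
  forall x j, 0 < util j x -> j != t -> (grade j x <= grade t x)%R ->
    util t x <= util_opt t (mu t).
Proof.
rewrite -util_optE; split=> [/allP ok x j u_gt0 ne_jt le_g|ok].
  have := ok (course_node x); rewrite mem_iota_size course_node_leq => /(_ isT) /allP.
  move/(_ (ta_node j)); rewrite mem_iota_size ta_node_leq => /(_ isT).
  rewrite edge_node u_gt0 (inj_eq ta_node_inj) ne_jt !num_node !den_node.
  by rewrite -ler_rat_nat ?grade_ge0 // le_g util_node.
apply/allP => a _; apply/allP => b _; apply/implyP.
case/andP => edge_ab; have /and3P[/is_courseP[x eq_a] /is_taP[j eq_b] _] := edge_ab.
move: edge_ab; rewrite eq_a eq_b edge_node (inj_eq ta_node_inj) !num_node !den_node.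
by rewrite -ler_rat_nat ?grade_ge0 // util_node => u_gt0 /andP[]; apply: ok u_gt0.
Qed.

End Matching.

(** * Orientations and MEFE matchings correspond *)

Definition matching_of (D : nat -> nat) : matching I :=
  [ffun t : ta I => [pick x | course_node x == D (ta_node t)]].

Lemma oriented_MEFE D : oriented s D -> MEFE (matching_of D).
Proof.
set mu := matching_of D => D_ok.
have mu_assigned t x : mu t = Some x <-> D (ta_node t) = course_node x.
  rewrite /mu ffunE; case: pickP => [y /eqP <-|no]; split=> //.
  - by case=> ->.
  - by move/course_node_inj => ->.
  - by move=> Dt; have := no x; rewrite Dt eqxx.
have D_ta t : D (ta_node t) = ta_node t \/
    exists2 x, D (ta_node t) = course_node x & 0 < util t x.
  have [/andP[/orP[/eqP Dt|/adj_taP[x Dt u_gt0]] _] _] := D_ok _ (node_ta t).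
    by left.
  by right; exists x.
have mu_excluded t x : mu t = Some x <-> 0 < util t x /\ D (course_node x) != ta_node t.
  have xorD : 0 < util t x ->
      (D (course_node x) == ta_node t) != (D (ta_node t) == course_node x).
    move=> u_gt0; have [_] := D_ok _ (node_course x).
    by apply; rewrite adj_course_ta.
  rewrite mu_assigned; split=> [Dt|[/xorD /[swap] /negPf->]]; last first.
    by case: (_ =P course_node x).
  have u_gt0 : 0 < util t x.
    case: (D_ta t) => [Dt'|[y Dt' uy]]; last first.
      by move: Dt; rewrite Dt' => /course_node_inj <-.
    by move/eqP: Dt; rewrite Dt' eq_sym course_ta_neq.
  by split=> //; have := xorD u_gt0; rewrite Dt eqxx; case: (_ == ta_node t).
have D_ta' t : D (ta_node t) = ta_node t \/ exists x, D (ta_node t) = course_node x.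
  by case: (D_ta t) => [|[x]]; [left | right; exists x].
have c_ok x : #|[set t : ta I | mu t == Some x]| = capacity x /\
    (threshold I <= avg_util mu x)%R.
  apply/(course_ok_matching mu_excluded).
  have [/andP[_ /orP[/andP[_ ok]|/andP[tx _]]] _] := D_ok _ (node_course x) => //.
  by rewrite is_ta_courseF in tx.
have t_ok t : ta_ok s (ta_node t) (D (ta_node t)).
  have [/andP[_ /orP[/andP[ct _]|/andP[_ ok]]] _] := D_ok _ (node_ta t) => //.
  by rewrite is_course_taF in ct.
split; first split.
- by move=> x; case: (c_ok x).
- by move=> t [x /mu_excluded[u_gt0 _] u0]; rewrite u0 in u_gt0.
- by move=> x; case: (c_ok x).
move=> [i [j [x [mu_j le_g]]]]; apply/negP; rewrite -leqNgt.
(* [ta_ok] omits the TA itself, which cannot envy its own place. *)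
case: (eqVneq j i) => [<-|ne_ji]; first by rewrite mu_j.
apply: ((ta_ok_matching mu_assigned D_ta' i).1 (t_ok i) x j) => //.
by case/mu_excluded: mu_j.
Qed.

(** Under the degree condition a feasible matching leaves at most one candidate for the choice of
    the TA left out. Courses that leave out none and unassigned TAs carry loops. *)
Definition orientation_of (mu : matching I) (a : nat) : nat :=
  if [pick x | course_node x == a] is Some x then
    if [pick t | (0 < util t x) && (mu t != Some x)] is Some t then ta_node t else a
  else if [pick t | ta_node t == a] is Some t then
    if mu t is Some x then course_node x else a
  else a.

Lemma orientation_of_course mu x : orientation_of mu (course_node x) =
  if [pick t | (0 < util t x) && (mu t != Some x)] is Some t then ta_node t
  else course_node x.
Proof.
rewrite /orientation_of; case: pickP => [y /eqP/course_node_inj-> //|no].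
by have := no x; rewrite eqxx.
Qed.

Lemma orientation_of_ta mu t : orientation_of mu (ta_node t) =
  if mu t is Some x then course_node x else ta_node t.
Proof.
rewrite /orientation_of; case: pickP => [y|_]; first by rewrite course_ta_neq.
case: pickP => [u /eqP/ta_node_inj-> //|no].
by have := no t; rewrite eqxx.
Qed.

Lemma MEFE_oriented mu :
    (forall x : course I, degree x <= (capacity x).+1) -> MEFE mu ->
  oriented s (orientation_of mu).
Proof.
move=> deg [[card_mu mu_util] sat_mu envy_mu]; set D := orientation_of mu.
have mu_gt0 t x : mu t = Some x -> 0 < util t x.
  by move=> mu_t; rewrite lt0n; apply/eqP => u0; apply: (mu_util t); exists x.
have mu_assigned t x : mu t = Some x <-> D (ta_node t) = course_node x.
  rewrite /D orientation_of_ta; case: (mu t) => [y|]; split=> //.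
  - by case=> ->.
  - by move/course_node_inj => ->.
  - by move/eqP; rewrite eq_sym course_ta_neq.
(* The degree condition enters here: two TAs left out, together with the [capacity x] TAs taken,
   would exceed the degree. *)
have excluded_uniq x t u : 0 < util t x -> mu t != Some x ->
    0 < util u x -> mu u != Some x -> t = u.
  move=> ut mt uu mun; apply/eqP/negPn/negP => ne_tu.
  have := deg x; rewrite leqNgt => /negP[]; rewrite -card_mu ltnNge.
  apply/negP => le_deg.
  have sub : [set t; u] :|: [set t | mu t == Some x] \subset [set t : ta I | 0 < value x t].
    apply/subsetP => w; rewrite !inE lt0n value_eq0 -lt0n.
    by case/orP => [/orP[/eqP->|/eqP->]|/eqP/mu_gt0].
  have dis : [disjoint [set t; u] & [set t | mu t == Some x]].
    rewrite disjoint_sym disjoints_subset; apply/subsetP => w; rewrite !inE.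
    by case: eqP => // mw _; apply/norP; split; apply: contraTneq isT => eq_w;
      [move: mt | move: mun]; rewrite -eq_w mw eqxx.
  have := leq_trans (subset_leq_card sub) le_deg.
  by rewrite cardsU (disjoint_setI0 dis) cards0 subn0 cards2 ne_tu !addSn ltnn.
have mu_excluded t x : mu t = Some x <-> 0 < util t x /\ D (course_node x) != ta_node t.
  rewrite /D orientation_of_course; case: pickP => [u /andP[uu mun]|no]; last first.
    split=> [/mu_gt0|[ut _]]; first by rewrite course_ta_neq.
    by have := no t; rewrite ut /= => /negbFE/eqP.
  rewrite (inj_eq ta_node_inj); split=> [mt|[ut ne_ut]].
    by split; [apply: mu_gt0 | apply: contraNneq mun => ->; apply/eqP].
  apply/eqP; apply: contraNT ne_ut => mt.
  by rewrite (excluded_uniq x u t).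
have D_ta t : D (ta_node t) = ta_node t \/ exists x, D (ta_node t) = course_node x.
  by rewrite /D orientation_of_ta; case: (mu t) => [x|]; [right; exists x | left].
have xorD t x : 0 < util t x ->
    (D (course_node x) == ta_node t) != (D (ta_node t) == course_node x).
  move=> ut; case: (eqVneq (D (ta_node t)) (course_node x)) => [|ne].
    by move/mu_assigned/mu_excluded=> [_ /negPf->].
  case: (eqVneq (D (course_node x)) (ta_node t)) => // neD.
  by case/eqP: ne; apply/mu_assigned/mu_excluded.
move=> a; rewrite nodeE => /orP[/is_courseP[x ->]|/is_taP[t ->]]; split.
- apply/andP; split; last first.
    by apply/orP; left; rewrite is_course_node; apply/(course_ok_matching mu_excluded).
  rewrite /D orientation_of_course; case: pickP => [t /andP[ut _]|_]; last by rewrite eqxx.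
  by rewrite adj_course_ta ut orbT.
- by move=> b /adj_courseP[t -> ut]; apply: xorD.
- apply/andP; split.
    rewrite /D orientation_of_ta; case def_mu: (mu t) => [x|]; last by rewrite eqxx.
    by rewrite adj_sym adj_course_ta mu_gt0 ?orbT.
  apply/orP; right; rewrite is_ta_node /=; apply/(ta_ok_matching mu_assigned D_ta).
  move=> x j uj ne_jt le_g; rewrite leqNgt; apply/negP => lt_u.
  (* If [j] is not in [x], it is the only TA that [x] leaves out; then [t], which values [x], is in
     [x] and gains nothing there. *)
  case: (eqVneq (mu j) (Some x)) => [mj|mj].
    by apply: envy_mu; exists t, j, x.
  case: (eqVneq (mu t) (Some x)) => [mt|mt]; first by rewrite mt ltnn in lt_u.
  have ut : 0 < util t x by apply: leq_ltn_trans lt_u.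
  by rewrite (excluded_uniq x j t) ?eqxx in ne_jt.
- move=> b /adj_taP[x -> ut]; rewrite eq_sym; exact: xorD.
Qed.

Lemma encode_matching_of D M k : oriented s D ->
    (forall t, t < m -> M (k + t) = answer_item s D (n + t.+1)) ->
  [seq M i | i <- iota k m] = encode_matching (matching_of D).
Proof.
move=> D_ok ME; apply: (@eq_from_nth _ 0).
  by rewrite size_map size_iota /encode_matching size_map size_enum_ord.
rewrite size_map size_iota => i lt_i.
rewrite (nth_map 0) ?size_iota // nth_iota // ME //.
rewrite -[i]/(nat_of_ord (Ordinal lt_i)) nth_enum_map ffunE /answer_item item1.
set t := Ordinal lt_i; rewrite -/(ta_node t).
case: pickP => [x /eqP <-|no]; first by rewrite /course_node ltn_ord.
case: ifP => // le_D; case: (posnP (D (ta_node t))) => // D_gt0.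
have lt_D : (D (ta_node t)).-1 < n by rewrite prednK.
by have := no (Ordinal lt_D); rewrite /course_node /= prednK // eqxx.
Qed.

End Encoding.

Theorem theorem4 :
  exists (P : program) (p : {poly nat}),
    forall I : instance,
      (forall x : course I, ((degree x)%:Z - (capacity x)%:Z <= 1)%R) ->
      exists (answer : option (matching I)) (time : nat) (M : memory),
        [/\ exec P 0 (load (encode I)) time M,
            time <= p.[bitsize (encode I)]%R,
            output M = encode_answer answer
          & match answer with
            | Some mu => MEFE mu
            | None => ~ exists mu : matching I, MEFE mu
            end].
Proof.
have [p P_ok] : exists p : {poly nat}, forall s : seq nat, exists H0 : store,
    (forall i, 0 < i <= size s -> H0 Input (pos (size s) i) = load s i) /\
    let H := run (size s) (fun=> size s) mefe_solver H0 in
    (H Output 0 <= size s ->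
     exists time M, [/\ exec (ram_program mefe_solver) 0 (load s) time M,
       time <= p.[bitsize s]%R &
       output M = [seq H Output (pos (H Output 0) i) | i <- iota 1 (H Output 0)]]).
  (* Both side conditions are closed computations on the solver: the registers it uses fit below
     [nreg], and its stores have the restricted form. *)
  by apply: ram_programP; vm_compute.
exists (ram_program mefe_solver), p => I deg.
have {}deg (x : course I) : degree x <= (capacity x).+1.
  by have := deg x; rewrite lerBlDr -PoszD lez_nat add1n.
have [H0 [H0_ok run_ok]] := P_ok (encode I); set s := encode I in H0_ok run_ok *.
pose O := run (size s) (fun=> size s) mefe_solver H0 Output.
have {}run_ok : O 0 <= size s -> exists time M,
    [/\ exec (ram_program mefe_solver) 0 (load s) time M, time <= p.[bitsize s]%R &
      output M = [seq O (pos (O 0) i) | i <- iota 1 (O 0)]] := run_ok.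
have nm_le : item s 1 + item s 2 <= size s by rewrite item1 item2 size_nm.
have m_lt : item s 2 < size s by rewrite item2 size_m.
case: (solverP nm_le m_lt H0_ok) => [[D [D_ok]]|[no_D]]; rewrite -/O.
  rewrite item2 => O0 O1 Oitem; rewrite item2 in m_lt; rewrite O0 in run_ok.
  have [time [M [ex le_time out]]] := run_ok m_lt.
  exists (Some (matching_of I D)), time, M; split=> //; last exact: oriented_MEFE.
  rewrite out [iota _ _]/= map_cons O1 /=; congr (_ :: _).
  by rewrite -(encode_matching_of (M := fun i => O (pos (nb_tas I).+1 i)) (k := 2) D_ok) //.
move=> O0 O1; rewrite O0 in run_ok.
have [time [M [ex le_time out]]] := run_ok (leq_ltn_trans (leq0n _) m_lt).
exists None, time, M; split=> //; first by rewrite out /= O1.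
by move=> [mu mu_ok]; apply: no_D; exists (orientation_of mu); apply: MEFE_oriented.
Qed.
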